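(* The quadratically enriched count $\sum_{p\in\Gamma}\mathrm{Tr}_{k(p)/k}\langle\mathrm{Jac}_p(Q_1,\ldots,Q_n)\rangle\in\mathrm{GW}(k)$ of the points of $\Gamma$ does not satisfy invariance of number, although its classical analogue $\sum_{p\in\Gamma}[k(p):k]$ does. That is: there exist a perfect field $k$ of characteristic not $2$, an odd integer $n\ge 3$, and two general choices of $n$-tuples $(Q_1,\ldots,Q_n)$ of quadrics in $\mathbb{P}^n_k$ vanishing on $\Lambda=\{x_3=\cdots=x_n=0\}\cong\mathbb{P}^2_k$ for which the resulting elements of $\mathrm{GW}(k)$ are different, whereas the integer $\sum_{p\in\Gamma}[k(p):k]$ is the same for all general choices.
   Context: For a general choice (i.e. in a nonempty open subset of the parameter space) of homogeneous degree $2$ polynomials $Q_1,\dots,Q_n\in k[x_0,\dots,x_n]$ vanishing on $\Lambda$, the scheme $\bigcap_{i=1}^n\{Q_i=0\}$ is $\Lambda\coprod\Gamma$ with $\Gamma$ finite étale over $k$. $\mathrm{GW}(k)$ is the Grothendieck--Witt group; $\langle a\rangle$ is the class of $(x,y)\mapsto axy$; $\mathrm{Tr}_{E/k}:\mathrm{GW}(E)\to\mathrm{GW}(k)$ is composition of forms with the field trace. For $p\in\Gamma$, $\mathrm{Jac}_p(Q_1,\dots,Q_n)\in k(p)^\times$ is the determinant of the intrinsic derivative at $p$ of the section $(Q_1,\dots,Q_n)$ of $\mathcal{O}(2)^n$, which lies in the fiber of $\mathrm{Hom}(\det T\mathbb{P}^n,\det\mathcal{O}(2)^n)\cong\mathcal{O}(\frac{n-1}2)^{\otimes2}$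 and is identified with a scalar, well defined up to squares, by trivializing the fiber of $\mathcal{O}(\frac{n-1}2)$ at $p$. Explicitly, if $x_\ell\ne0$ at $p$, it is $(-1)^\ell\det\big(\partial(Q_i/x_\ell^2)/\partial(x_j/x_\ell)\big)_{i;\,j\neq\ell}$ evaluated at $p$. *)

(* Defs.v *)
From HB Require Import structures.
From mathcomp Require Import all_boot all_order all_algebra all_field.
From mathcomp Require Import generic_quotient boolp mpoly.

Set Implicit Arguments.
Unset Strict Implicit.
Unset Printing Implicit Defensive.

Import GRing.Theory.
Local Open Scope ring_scope.
Local Open Scope quotient_scope.

Definition perfect_field (k : fieldType) : Prop :=
  forall f : {poly k}, irreducible_poly f -> separable_poly f.

(* A nondegenerate symmetric bilinear form over k is given by its Gram matrix,
   an invertible symmetric matrix; isometry is congruence. *)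

Section Isometry.
Variable k : fieldType.

Definition symform (A : {m : nat & 'M[k]_m}) : bool :=
  ((tagged A)^T == tagged A) && (tagged A \in unitmx).

Record symbform := SymbForm { gram : {m : nat & 'M[k]_m}; gramP : symform gram }.

HB.instance Definition _ := [isSub for gram].
HB.instance Definition _ := [Choice of symbform by <:].

(* The invertible matrix P is allowed to be rectangular a priori (which forces
   m = n), so that no cast is needed to compare forms of different origin. *)
Definition congruent m n (A : 'M[k]_m) (B : 'M[k]_n) : Prop :=
  exists (P : 'M[k]_(m, n)) (P' : 'M[k]_(n, m)),
    [/\ P *m P' = 1%:M, P' *m P = 1%:M & P *m B *m P^T = A].

Definition isometric (a b : symbform) : Prop :=
  congruent (tagged (gram a)) (tagged (gram b)).

Definition dsum_mx m n (A : 'M[k]_m) (B : 'M[k]_n) : 'M[k]_(m + n) :=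
  block_mx A 0 0 B.

Lemma dsum_symform (a b : symbform) :
  symform (Tagged (fun m => 'M[k]_m)
                  (dsum_mx (tagged (gram a)) (tagged (gram b)))).
Proof.
case: a b => [[m A] /= /andP[/= sA uA]] [[n B] /= /andP[/= sB uB]].
rewrite /symform /= /dsum_mx tr_block_mx !trmx0 (eqP sA) (eqP sB) eqxx /=.
by rewrite unitmxE det_ublock unitrM -!unitmxE uA uB.
Qed.

Definition dsum (a b : symbform) : symbform := SymbForm (dsum_symform a b).

Lemma symbform0_subproof : symform (Tagged (fun m => 'M[k]_m) (0 : 'M[k]_0)).
Proof. by rewrite /symform /= trmx0 eqxx /= unitmxE det_mx00 unitr1. Qed.

Definition symbform0 : symbform := SymbForm symbform0_subproof.

Lemma congruent_refl m (A : 'M[k]_m) : congruent A A.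
Proof. by exists 1%:M, 1%:M; rewrite trmx1 !mulmx1 mul1mx. Qed.

Lemma congruent_sym m n (A : 'M[k]_m) (B : 'M[k]_n) :
  congruent A B -> congruent B A.
Proof.
case=> P [P' [PP' P'P <-]]; exists P', P; split=> //.
rewrite -!mulmxA -trmx_mul P'P trmx1 mulmx1.
by rewrite mulmxA P'P mul1mx.
Qed.

Lemma congruent_trans m n p (A : 'M[k]_m) (B : 'M[k]_n) (C : 'M[k]_p) :
  congruent A B -> congruent B C -> congruent A C.
Proof.
case=> P [P' [PP' P'P <-]] [R [R' [RR' R'R <-]]].
exists (P *m R), (R' *m P'); split.
- by rewrite mulmxA -(mulmxA P) RR' mulmx1.
- by rewrite mulmxA -(mulmxA R') P'P mulmx1.
- by rewrite trmx_mul !mulmxA.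
Qed.

Lemma congruent_dsum m n m' n' (A : 'M[k]_m) (B : 'M[k]_n)
    (A' : 'M[k]_m') (B' : 'M[k]_n') :
  congruent A A' -> congruent B B' ->
  congruent (dsum_mx A B) (dsum_mx A' B').
Proof.
case=> P [P' [PP' P'P <-]] [R [R' [RR' R'R <-]]].
exists (block_mx P 0 0 R), (block_mx P' 0 0 R'); rewrite /dsum_mx; split.
- by rewrite mulmx_block !mulmx0 !mul0mx !addr0 add0r PP' RR' -scalar_mx_block.
- by rewrite mulmx_block !mulmx0 !mul0mx !addr0 add0r P'P R'R -scalar_mx_block.
- by rewrite tr_block_mx !trmx0 !mulmx_block !(mulmx0, mul0mx, addr0, add0r).
Qed.

Lemma congruent_cast m n (e : m = n) (A : 'M[k]_m) :
  congruent A (castmx (e, e) A).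
Proof. by case: n / e; rewrite castmx_id; apply: congruent_refl. Qed.

Lemma congruent_dsumA m n p (A : 'M[k]_m) (B : 'M[k]_n) (C : 'M[k]_p) :
  congruent (dsum_mx A (dsum_mx B C)) (dsum_mx (dsum_mx A B) C).
Proof.
have := @block_mxA _ m n p m n p A 0 0 0 B 0 0 0 C.
rewrite /= !row_mx0 !col_mx0 /dsum_mx => ->.
exact/congruent_sym/congruent_cast.
Qed.

Lemma congruent_dsumC m n (A : 'M[k]_m) (B : 'M[k]_n) :
  congruent (dsum_mx A B) (dsum_mx B A).
Proof.
exists (block_mx 0 1%:M 1%:M 0), (block_mx 0 1%:M 1%:M 0).
rewrite /dsum_mx tr_block_mx !trmx0 !trmx1.
by rewrite !mulmx_block !(mulmx0, mul0mx, mulmx1, mul1mx, addr0, add0r)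
           -!scalar_mx_block.
Qed.

Lemma congruent_dsum0 n (A : 'M[k]_0) (B : 'M[k]_n) :
  congruent (dsum_mx A B) B.
Proof.
exists (col_mx 0 1%:M), (row_mx 0 1%:M); split.
- rewrite mul_col_row !mul0mx !mulmx1 !mulmx0 [RHS]scalar_mx_block.
  by congr block_mx; apply/matrixP=> -[].
- by rewrite mul_row_col mul0mx mulmx1 add0r.
- rewrite mul_col_mx mul0mx mul1mx tr_col_mx trmx0 trmx1 mul_col_row.
  by rewrite !mul0mx !mulmx0 mulmx1; congr block_mx; apply/matrixP=> -[].
Qed.

Lemma isometric_refl a : isometric a a. Proof. exact: congruent_refl. Qed.
Lemma isometric_sym a b : isometric a b -> isometric b a.
Proof. exact: congruent_sym. Qed.
Lemma isometric_trans a b c : isometric a b -> isometric b c -> isometric a c.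
Proof. exact: congruent_trans. Qed.
Lemma isometric_dsum a a' b b' :
  isometric a a' -> isometric b b' -> isometric (dsum a b) (dsum a' b').
Proof. exact: congruent_dsum. Qed.
Lemma isometric_dsumA a b c :
  isometric (dsum a (dsum b c)) (dsum (dsum a b) c).
Proof. exact: congruent_dsumA. Qed.
Lemma isometric_dsumC a b : isometric (dsum a b) (dsum b a).
Proof. exact: congruent_dsumC. Qed.
Lemma isometric_dsum0 a : isometric (dsum symbform0 a) a.
Proof. exact: congruent_dsum0. Qed.

Lemma isometric_dsumCA a b c :
  isometric (dsum a (dsum b c)) (dsum b (dsum a c)).
Proof.
apply: isometric_trans (isometric_dsumA _ _ _) _.
apply: isometric_trans (isometric_sym (isometric_dsumA _ _ _)).
exact: isometric_dsum (isometric_dsumC _ _) (isometric_refl _).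
Qed.

Lemma isometric_dsumACA a b c d :
  isometric (dsum (dsum a b) (dsum c d)) (dsum (dsum a c) (dsum b d)).
Proof.
apply: isometric_trans (isometric_sym (isometric_dsumA _ _ _)) _.
apply: isometric_trans (isometric_dsumA _ _ _).
exact: isometric_dsum (isometric_refl _) (isometric_dsumCA _ _ _).
Qed.

(* (a, b) stands for the formal difference [a] - [b] *)
Definition gw_equiv (x y : symbform * symbform) : bool :=
  `[< exists c, isometric (dsum (dsum x.1 y.2) c) (dsum (dsum y.1 x.2) c) >].

Lemma gw_equiv_refl : reflexive gw_equiv.
Proof. by move=> x; apply/asboolP; exists symbform0; apply: isometric_refl. Qed.

Lemma gw_equiv_sym : ssrbool.symmetric gw_equiv.
Proof.
by move=> x y; apply/asboolP/asboolP=> -[c /isometric_sym h]; exists c.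
Qed.

Lemma gw_equiv_trans : transitive gw_equiv.
Proof.
move=> y x z /asboolP[c xy] /asboolP[d yz]; apply/asboolP.
exists (dsum (dsum y.1 y.2) (dsum c d)).
have shuffle (a b p q c' d' : symbform) :
    isometric (dsum (dsum a b) (dsum (dsum p q) (dsum c' d')))
              (dsum (dsum (dsum a q) c') (dsum (dsum p b) d')).
  apply: isometric_trans (isometric_dsumA _ _ _) _.
  apply: isometric_trans (isometric_dsumACA _ _ _ _).
  apply: isometric_dsum (isometric_refl _).
  apply: isometric_trans (isometric_dsum (isometric_refl _) (isometric_dsumC _ _)) _.
  apply: isometric_trans (isometric_dsumACA _ _ _ _) _.
  exact: isometric_dsum (isometric_refl _) (isometric_dsumC _ _).
apply: isometric_trans (shuffle _ _ _ _ _ _) _.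
apply: isometric_trans (isometric_dsum xy yz) _.
apply: isometric_trans (isometric_dsumC _ _) _.
apply: isometric_trans (isometric_sym (shuffle _ _ _ _ _ _)) _.
apply: isometric_dsum (isometric_refl _) _.
apply: isometric_dsum (isometric_refl _) (isometric_dsumC _ _).
Qed.

Canonical gw_equiv_equivrel :=
  EquivRel gw_equiv gw_equiv_refl gw_equiv_sym gw_equiv_trans.

End Isometry.

Definition GW (k : fieldType) := {eq_quot (gw_equiv (k := k))}.

HB.instance Definition _ (k : fieldType) := EqQuotient.on (GW k).
HB.instance Definition _ (k : fieldType) := Choice.on (GW k).

Section GWGroup.
Variable k : fieldType.
Local Notation symbform := (symbform k).

Definition gw_pair_add (x y : symbform * symbform) : symbform * symbform :=
  (dsum x.1 y.1, dsum x.2 y.2).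
Definition gw_pair_opp (x : symbform * symbform) : symbform * symbform := (x.2, x.1).

Definition gw_add : GW k -> GW k -> GW k := lift_op2 (GW k) gw_pair_add.
Definition gw_opp : GW k -> GW k := lift_op1 (GW k) gw_pair_opp.
Definition gw0 : GW k := \pi_(GW k) (symbform0 k, symbform0 k).

Lemma gw_eqP (x y : symbform * symbform) :
  reflect (exists c, isometric (dsum (dsum x.1 y.2) c) (dsum (dsum y.1 x.2) c))
          (\pi_(GW k) x == \pi_(GW k) y).
Proof. by rewrite piE; apply: asboolP. Qed.

Lemma gw_eq0 (x y : symbform * symbform) :
  isometric (dsum x.1 y.2) (dsum y.1 x.2) -> \pi_(GW k) x = \pi_(GW k) y.
Proof.
move=> h; apply/eqP/gw_eqP; exists (symbform0 k).
exact: isometric_dsum (isometric_refl _).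
Qed.

Lemma pi_gw_add : {morph \pi_(GW k) : x y / gw_pair_add x y >-> gw_add x y}.
Proof.
move=> x y; unlock gw_add; apply/eqP/gw_eqP => /=.
have /eqP/gw_eqP[c hc] := reprK (\pi_(GW k) x).
have /eqP/gw_eqP[d hd] := reprK (\pi_(GW k) y).
exists (dsum c d).
have sh (a b a' b' c' d' : symbform) :
    isometric (dsum (dsum (dsum a a') (dsum b b')) (dsum c' d'))
              (dsum (dsum (dsum a b) c') (dsum (dsum a' b') d')).
  apply: isometric_trans (isometric_dsumACA _ _ _ _).
  exact: isometric_dsum (isometric_dsumACA _ _ _ _) (isometric_refl _).
apply: isometric_trans (sh _ _ _ _ _ _) _.
apply: isometric_trans (isometric_sym (sh _ _ _ _ _ _)).
by apply: isometric_dsum; apply: isometric_sym.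
Qed.
Canonical pi_gw_add_morph := PiMorph2 pi_gw_add.

Lemma pi_gw_opp : {morph \pi_(GW k) : x / gw_pair_opp x >-> gw_opp x}.
Proof.
move=> x; unlock gw_opp; apply/eqP/gw_eqP => /=.
have /eqP/gw_eqP[c hc] := reprK (\pi_(GW k) x).
exists c.
apply: isometric_trans
  (isometric_dsum (isometric_dsumC _ _) (isometric_refl _)) _.
apply: isometric_trans hc _.
exact: isometric_dsum (isometric_dsumC _ _) (isometric_refl _).
Qed.
Canonical pi_gw_opp_morph := PiMorph1 pi_gw_opp.

Lemma gw_addA : associative gw_add.
Proof.
elim/quotW=> x; elim/quotW=> y; elim/quotW=> z; rewrite !piE.
apply: gw_eq0 => /=; apply: isometric_dsum; first exact: isometric_dsumA.
exact/isometric_sym/isometric_dsumA.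
Qed.

Lemma gw_addC : commutative gw_add.
Proof.
elim/quotW=> x; elim/quotW=> y; rewrite !piE.
by apply: gw_eq0 => /=; apply: isometric_dsum; apply: isometric_dsumC.
Qed.

Lemma gw_add0 : left_id gw0 gw_add.
Proof.
elim/quotW=> x; rewrite /gw0 !piE; apply: gw_eq0 => /=.
apply: isometric_dsum; first exact: isometric_dsum0.
exact/isometric_sym/isometric_dsum0.
Qed.

Lemma gw_addN : left_inverse gw0 gw_opp gw_add.
Proof.
elim/quotW=> x; rewrite /gw0 !piE; apply: gw_eq0 => /=.
apply: isometric_trans (isometric_dsumC _ _) _.
exact: isometric_dsum (isometric_refl _) (isometric_dsumC _ _).
Qed.

HB.instance Definition _ :=
  GRing.isZmodule.Build (GW k) gw_addA gw_addC gw_add0 gw_addN.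

End GWGroup.

Definition gw_of_form (k : fieldType) (a : symbform k) : GW k :=
  \pi_(GW k) (a, symbform0 k).

(* The class of a bilinear form on a finite-dimensional space, by way of its
   Gram matrix in a basis; it is a total function, with the dummy value 0 when
   the form is not symmetric or is degenerate. *)
Definition gram_matrix (k : fieldType) (V : vectType k) (b : V -> V -> k) :
    'M[k]_(\dim {:V}) :=
  \matrix_(i, j) b (vbasis {:V})`_i (vbasis {:V})`_j.

Definition gw_class (k : fieldType) (V : vectType k) (b : V -> V -> k) : GW k :=
  if insub (Tagged (fun m => 'M[k]_m) (gram_matrix b)) is Some a
  then gw_of_form a else 0.

Definition field_trace (k : fieldType) (E : fieldExtType k) (x : E) : k :=
  \tr (passmx.mxof (vbasis {:E}) (vbasis {:E}) (amull x)).

(* Tr_{E/k} <a> : the E-bilinear form (x, y) |-> a x y on E, followed by the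
   field trace, on the k-vector space E. *)
Definition gw_trace_unit (k : fieldType) (E : fieldExtType k) (a : E) : GW k :=
  gw_class (fun x y : E => field_trace (a * x * y)).

Section Projective.
Variables (k : fieldType) (n : nat).

(* A closed point p of P^n: its residue field k(p) and homogeneous coordinates
   of p in k(p), whose ratios generate k(p). Two such data may be isomorphic;
   the point itself is the homogeneous prime ideal of the forms vanishing at
   these coordinates. *)
Record closed_point := ClosedPoint {
  resfield : fieldExtType k;
  coord_of : 'I_n.+1 -> resfield;
  coord_neq0 : exists l, coord_of l != 0;
  coord_gen : <<1 & [seq coord_of i / coord_of j | i <- enum 'I_n.+1,
                                             j <- enum 'I_n.+1]>>%VS = fullv
}.

Definition eval_at (E : fieldExtType k) (F : {mpoly k[n.+1]})
  (x : 'I_n.+1 -> E) : E := mmap (GRing.in_alg E) x F.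

Definition vanishes_at (F : {mpoly k[n.+1]}) (p : closed_point) : Prop :=
  eval_at F (@coord_of p) = 0.

Definition same_point (p q : closed_point) : Prop :=
  forall d (F : {mpoly k[n.+1]}), F \is d.-homog ->
    vanishes_at F p <-> vanishes_at F q.

Definition in_ideal (I : finType) (P : pred I) (g : I -> {mpoly k[n.+1]})
    (F : {mpoly k[n.+1]}) : Prop :=
  exists h : I -> {mpoly k[n.+1]}, F = \sum_(i | P i) h i * g i.

(* The homogeneous ideal of Lambda = {x_3 = ... = x_n = 0}. *)
Definition in_ideal_Lambda : {mpoly k[n.+1]} -> Prop :=
  in_ideal [pred j : 'I_n.+1 | 3 <= j]%N (fun j => 'X_j).

Definition on_Lambda (p : closed_point) : Prop :=
  forall j : 'I_n.+1, (3 <= j)%N -> coord_of p j = 0.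

(* Homogeneous coordinate ideal of the scheme \bigcap_i {Q_i = 0}: saturation
   of (Q_1, ..., Q_n) with respect to the irrelevant ideal. *)
Definition in_saturation (Q : 'I_n -> {mpoly k[n.+1]}) (F : {mpoly k[n.+1]}) :=
  exists N, forall m : 'X_{1..n.+1}, mdeg m = N -> in_ideal predT Q ('X_[m] * F).

Definition quadrics_through_Lambda (Q : 'I_n -> {mpoly k[n.+1]}) : Prop :=
  forall i, Q i \is 2.-homog /\ in_ideal_Lambda (Q i).

(* \bigcap_i {Q_i = 0} = Lambda \coprod Gamma as closed subschemes of P^n,
   where Gamma = \coprod_(i < r) Spec k(p_i) with every k(p_i)/k finite
   separable, i.e. Gamma is finite etale over k with closed points the p_i.
   Closed subschemes are compared by their saturated homogeneous ideals. *)
Record is_residual (Q : 'I_n -> {mpoly k[n.+1]}) (r : nat)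
    (p : 'I_r -> closed_point) : Prop := IsResidual {
  residual_distinct : forall i j, same_point (p i) (p j) -> i = j;
  residual_disjoint : forall i, ~ on_Lambda (p i);
  residual_separable : forall i, separable 1 {:resfield (p i)};
  residual_scheme : forall d (F : {mpoly k[n.+1]}), F \is d.-homog ->
    in_saturation Q F <->
    in_ideal_Lambda F /\ (forall i, vanishes_at F (p i))
}.

(* F / x_l^2 as a polynomial in the x_j / x_l, j != l, for F a quadratic form *)
Definition dehomog (l : 'I_n.+1) (F : {mpoly k[n.+1]}) : {mpoly k[n.+1]} :=
  F \mPo [tuple if j == l then 1 else 'X_j | j < n.+1].

Definition jac_chart (Q : 'I_n -> {mpoly k[n.+1]}) (p : closed_point)
    (l : 'I_n.+1) : resfield p :=
  (-1) ^+ l *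
  \det (\matrix_(i < n, j < n)
          eval_at (dehomog l (Q i))^`M(lift l j)
                  (fun m => coord_of p m / coord_of p l)).

(* computed in the first chart containing p; the class up to squares does not
   depend on the chart when n is odd *)
Definition jac (Q : 'I_n -> {mpoly k[n.+1]}) (p : closed_point) : resfield p :=
  jac_chart Q p (odflt ord0 [pick l | coord_of p l != 0]).

Definition gw_count (Q : 'I_n -> {mpoly k[n.+1]}) (r : nat)
    (p : 'I_r -> closed_point) : GW k :=
  \sum_(i < r) gw_trace_unit (jac Q (p i)).

Definition degree_count (r : nat) (p : 'I_r -> closed_point) : nat :=
  (\sum_(i < r) \dim {:resfield (p i)})%N.

(* The n-tuples of quadrics vanishing on Lambda form an affine space, with
   coordinates the coefficients of x_a x_b (a <= b, 3 <= b) in the Q_i. *)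
Definition param : finType :=
  {t : 'I_n * ('I_n.+1 * 'I_n.+1) | (t.2.1 <= t.2.2) && (3 <= t.2.2)}%N.

Definition param_coord (Q : 'I_n -> {mpoly k[n.+1]}) (t : param) : k :=
  (Q (val t).1)@_(U_((val t).2.1) + U_((val t).2.2)).

(* Membership of Q in the basic open subset D(f) of the parameter space; these
   subsets, for f != 0, are cofinal among its nonempty Zariski open subsets. *)
Definition in_basic_open (f : {mpoly k[#|param|]})
    (Q : 'I_n -> {mpoly k[n.+1]}) : Prop :=
  f.@[fun s => param_coord Q (enum_val s)] != 0.

End Projective.

(* Main.v *)
Require Import Defs.
From HB Require Import structures.
From mathcomp Require Import all_boot all_order all_algebra all_field.
From mathcomp Require Import ring zify.
From mathcomp Require Import boolp mpoly.

Set Implicit Arguments.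
Unset Strict Implicit.
Unset Printing Implicit Defensive.

Import GRing.Theory.
Local Open Scope ring_scope.

(** The enriched count already varies over the rationals for n = 3. There the
    quadrics through the plane are x_3 L_i with L_0, L_1, L_2 linear forms, and
    for L_i independent modulo x_3 the residual scheme is the rational point c
    where they vanish. The Jacobian at c is, up to a nonzero factor, a maximal minor of the
    coefficients of the L_i; replacing Q_0 by - Q_0 keeps c and negates the
    Jacobian, hence multiplies the discriminant of the count, an element of the
    nonzero rationals modulo squares, by -1, which is not a square. Both triples
    can be found in any nonempty open set, since a nonzero polynomial over an
    infinite field has a nonzero value ([gw_count_flip], [mpoly_nonroot]).

    That the degree of Gamma is constant is shown by comparing the ideals of two
    systems Q and Q' in a single large degree d, along the pencil
    (1 - t) Q + t Q'. Let l be the dimension of the space V of forms of degree d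
    vanishing on the plane, r the dimension of the part of degree d of the ideal
    of Q', and D, D' the degrees of Gamma, Gamma'.

    On the one hand l <= r + D' ([codim_gen_mx]): by hypothesis the ideal of Q'
    has, after saturation, codimension at most D' in V, and saturating changes
    nothing in large degrees. The latter holds because forms in V take arbitrary
    values on Gamma' in large degrees ([interpolation]), which shows that the
    saturated ideal is generated in bounded degrees
    ([residual_form_in_ideal]).

    On the other hand r + D <= l ([rank_gen_mx]), which is the conservation of
    number. As Gamma is reduced and disjoint from the plane and its residue
    fields are separable, the Jacobian matrix of Q at each of its points has
    rank n, so by Newton's method the points lift to solutions of the pencil
    with coordinates in k(p)[t], modulo any power of t ([lift_point]).
    Evaluation at the lifts gives D functionals on V[t], independent at t = 0,
    which kill the ideal of the pencil to arbitrary order; r elements of this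
    ideal are independent at t = 1. A determinant then forces r + D <= l
    ([rank_deformation]).

    Hence D <= D', and equality follows by exchanging the two systems. All
    dimensions are over k, each k(p)[t] being regarded as a module over k[t]. *)

(** * Ideals, homogeneous components and evaluation *)

Section Ideals.
Variables (k : fieldType) (n : nat) (I : finType) (P : pred I).
Variable (g : I -> {mpoly k[n.+1]}).
Local Notation in_ideal := (in_ideal P g).

Lemma in_ideal0 : in_ideal 0.
Proof. by exists (fun=> 0); rewrite big1 // => i _; rewrite mul0r. Qed.

Lemma in_idealD F G : in_ideal F -> in_ideal G -> in_ideal (F + G).
Proof.
case=> h -> [h' ->]; exists (fun i => h i + h' i).
by rewrite -big_split; apply: eq_bigr => i _; rewrite mulrDl.
Qed.

Lemma in_idealMl G F : in_ideal F -> in_ideal (G * F).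
Proof.
case=> h ->; exists (fun i => G * h i).
by rewrite mulr_sumr; apply: eq_bigr => i _; rewrite mulrA.
Qed.

Lemma in_idealZ c F : in_ideal F -> in_ideal (c *: F).
Proof. by rewrite -mul_mpolyC; apply: in_idealMl. Qed.

Lemma in_idealB F G : in_ideal F -> in_ideal G -> in_ideal (F - G).
Proof. by move=> hF hG; rewrite -scaleN1r; apply/in_idealD/in_idealZ. Qed.

Lemma in_ideal_sum (J : Type) (r : seq J) (R : pred J) F :
  (forall j, R j -> in_ideal (F j)) -> in_ideal (\sum_(j <- r | R j) F j).
Proof. by move=> hF; elim/big_ind: _ => //; [apply: in_ideal0 | apply: in_idealD]. Qed.

Lemma in_ideal_gen i : P i -> in_ideal (g i).
Proof.
move=> Pi; exists (fun j => (j == i)%:R).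
rewrite (bigD1 i) //= eqxx mul1r big1 ?addr0 // => j /andP[_ /negPf->].
by rewrite mul0r.
Qed.

Lemma in_ideal_sub (J : finType) (R : pred J) (g' : J -> {mpoly k[n.+1]}) F :
  (forall i, P i -> Defs.in_ideal R g' (g i)) -> in_ideal F ->
  Defs.in_ideal R g' F.
Proof.
move=> gg' [h ->]; elim/big_ind: _.
- by exists (fun=> 0); rewrite big1 // => i _; rewrite mul0r.
- move=> _ _ [h1 ->] [h2 ->]; exists (fun i => h1 i + h2 i).
  by rewrite -big_split; apply: eq_bigr => i _; rewrite mulrDl.
move=> i /gg'[h' ->]; exists (fun j => h i * h' j).
by rewrite mulr_sumr; apply: eq_bigr => j _; rewrite mulrA.
Qed.

End Ideals.

Section Homogeneous.
Variables (k : fieldType) (n : nat).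
Implicit Types (F G : {mpoly k[n]}).

Lemma dhomogM2 d e F G : F \is d.-homog -> G \is e.-homog ->
  F * G \is (d + e).-homog.
Proof. exact: dhomogM. Qed.

Lemma dhomogB d F G : F \is d.-homog -> G \is d.-homog -> F - G \is d.-homog.
Proof. by move=> hF hG; apply: rpredB. Qed.

Lemma dhomogXn j d : ('X_j ^+ d : {mpoly k[n]}) \is d.-homog.
Proof. by rewrite mpolyXn dhomogX /= mdegMn mdeg1 mul1n. Qed.

Lemma pihomogM d e F G : G \is e.-homog ->
  pihomog mdeg (d + e) (F * G) = pihomog mdeg d F * G.
Proof.
move=> hG; rewrite [F]mpolyE mulr_suml !linear_sum mulr_suml.
apply: eq_bigr => m _; rewrite -scalerAl !linearZ /= -scalerAl; congr (_ *: _).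
have hXG : 'X_[m] * G \is (mdeg m + e).-homog by rewrite dhomogM2 // dhomogX.
have [<-|ne] := eqVneq (mdeg m) d.
  by rewrite pihomog_dE // pihomog_dE // dhomogX /=.
rewrite (pihomog_ne0 _ hXG) ?eqn_add2r //.
by rewrite pihomogX /= (negPf ne) mul0r.
Qed.

(** Only the components of degree d of the coefficients contribute to F. *)
Lemma in_ideal_homog (I : finType) (Q : I -> {mpoly k[n]}) d F :
  (forall i, Q i \is 2.-homog) -> F \is (d + 2).-homog ->
  (exists h, F = \sum_i h i * Q i) ->
  exists h, (forall i, h i \is d.-homog) /\ F = \sum_i h i * Q i.
Proof.
move=> hQ hF [h Fh]; exists (fun i => pihomog mdeg d (h i)).
split=> [i|]; first exact: pihomogP.
rewrite -(pihomog_dE hF) {1}Fh linear_sum; apply: eq_bigr => i _.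
exact: pihomogM.
Qed.

(** The coefficients q are chosen before the algebra A: the same ones serve at a
    point over k(p) and along an arc over k(p)[t]. *)
Lemma quadric_matrix F : F \is 2.-homog ->
  exists q : 'I_n -> 'I_n -> k,
    forall (A : comNzRingType) (phi : {rmorphism k -> A}) (x : 'I_n -> A),
      mmap phi x F = \sum_a \sum_b phi (q a b) * (x a * x b).
Proof.
move=> hF; rewrite [F]mpolyE.
have : all [pred m : 'X_{1..n} | mdeg m == 2%N] (msupp F) by rewrite -dhomogE.
elim: (msupp F) => [_|m s IH /= /andP[/eqP dm /IH [q hq]]].
  exists (fun _ _ => 0) => A phi x; rewrite big_nil mmap0 big1 // => a _.
  by rewrite big1 // => b _; rewrite rmorph0 mul0r.
have [a [b ->]] : exists a b, m = (U_(a) + U_(b))%MM.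
  have /existsP[a ma] : [exists a, m a != 0%N].
    apply: contra_eqT dm; rewrite negb_exists => /forallP m0.
    rewrite mdegE big1 // => i _; apply/eqP; move: (m0 i); rewrite negbK //.
  have ma' : (U_(a) <= m)%MM by rewrite lep1mP.
  have /mdeg1P[b /eqP mb] : mdeg (m - U_(a)) == 1%N.
    by have := congr1 mdeg (submK ma'); rewrite mdegD mdeg1 dm addn1 => -[->].
  by exists b, a; rewrite -mb submK.
exists (fun i j => F@_(U_(a) + U_(b)) *+ ((i == a) && (j == b)) + q i j).
move=> A phi x; rewrite big_cons mmapD mmapZ mmapX hq.
have -> : mmap1 x (U_(a) + U_(b)) = x a * x b.
  by rewrite -(mmapX x phi) mpolyXD rmorphM /= !mmapX !mmap1U.
under [RHS]eq_bigr => i _ do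
  (under eq_bigr => j _ do rewrite rmorphD mulrDl; rewrite big_split).
rewrite big_split; congr (_ + _).
rewrite (bigD1 a) //= [X in _ + X]big1 ?addr0 => [|i /negPf ia]; last first.
  by rewrite big1 // => j _; rewrite ia mulr0n rmorph0 mul0r.
rewrite (bigD1 b) //= [X in _ + X]big1 ?addr0 ?eqxx // => j /negPf jb.
by rewrite jb andbF mulr0n rmorph0 mul0r.
Qed.

Lemma mnm_split d e (m : 'X_{1..n}) : mdeg m = (d + e)%N ->
  exists m1 m2, [/\ m = (m1 + m2)%MM, mdeg m1 = d & mdeg m2 = e].
Proof.
elim: d m => [|d IH] m dm.
  by exists 0%MM, m; rewrite add0m mdeg0.
have /existsP[a ma] : [exists a, m a != 0%N].
  apply: contra_eqT dm; rewrite negb_exists => /forallP m0.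
  rewrite mdegE big1 // => i _; apply/eqP; move: (m0 i); rewrite negbK //.
have ma' : (U_(a) <= m)%MM by rewrite lep1mP.
have /IH[m1 [m2 [E d1 d2]]] : mdeg (m - U_(a)) = (d + e)%N.
  by have := congr1 mdeg (submK ma'); rewrite mdegD mdeg1 dm addn1 addSn => -[->].
exists (U_(a) + m1)%MM, m2; split=> //; last by rewrite mdegD mdeg1 d1.
by rewrite -addmA -E addmC submK.
Qed.

Lemma mmap_map (A B : comNzRingType) (phi : {rmorphism k -> A})
    (psi : {rmorphism A -> B}) (x : 'I_n -> A) F :
  psi (mmap phi x F) = mmap (psi \o phi) (psi \o x) F.
Proof.
rewrite /mmap rmorph_sum; apply: eq_bigr => m _; rewrite rmorphM /mmap1.
by rewrite rmorph_prod; congr (_ * _); apply: eq_bigr => i _; rewrite rmorphXn.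
Qed.

Lemma mmap_ext (A : comNzRingType) (phi psi : {rmorphism k -> A})
    (x y : 'I_n -> A) F :
  phi =1 psi -> x =1 y -> mmap phi x F = mmap psi y F.
Proof.
move=> e1 e2; apply: eq_bigr => m _; rewrite e1; congr (_ * _).
exact: mmap1_eq.
Qed.

End Homogeneous.

(** * Forms of a given degree vanishing on the plane *)

Section Lambda.
Variables (k : fieldType) (n : nat).
Implicit Types (F G : {mpoly k[n.+1]}).

Definition off_plane (m : 'X_{1..n.+1}) :=
  [exists j : 'I_n.+1, (3 <= j)%N && (m j != 0%N)].

Lemma off_planeD m m' : off_plane m' -> off_plane (m + m').
Proof.
case/existsP=> j /andP[j3 mj]; apply/existsP; exists j; rewrite j3 mnmDE.
by rewrite addn_eq0 negb_and mj orbT.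
Qed.

Lemma in_LambdaX m : off_plane m -> in_ideal_Lambda ('X_[m] : {mpoly k[n.+1]}).
Proof.
case/existsP=> j /andP[j3 mj].
have /submK <- : (U_(j) <= m)%MM by rewrite lep1mP.
by rewrite mpolyXD; apply/in_idealMl/(@in_ideal_gen _ _ _ _ (fun j => 'X_j)).
Qed.

(** The plane being a coordinate subspace, its ideal is monomial. *)
Lemma in_LambdaP F : in_ideal_Lambda F <-> {in msupp F, forall m, off_plane m}.
Proof.
split=> [[h ->] m /msupp_sum_le /flatten_mapP[j]|hF].
  rewrite mem_filter => /andP[/= j3 _].
  rewrite (perm_mem (msuppMX _ _)) => /mapP[m' _ ->].
  apply/existsP; exists j; rewrite j3 mnmDE mnm1E eqxx //.
rewrite [F]mpolyE big_seq; apply: in_ideal_sum => m /hF mL.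
exact/in_idealZ/in_LambdaX.
Qed.

(** These monomials serve as coordinates on the space of forms of degree d
    vanishing on the plane; Ldim is its dimension. *)
Definition Lmons d : {set 'X_{1..n.+1 < d.+1}} :=
  [set m | (mdeg (bmnm m) == d) && off_plane m].
Definition Ldim d := #|Lmons d|.
Definition Lmon d (i : 'I_(Ldim d)) : 'X_{1..n.+1} := bmnm (enum_val i).
Definition Lrow d F : 'rV[k]_(Ldim d) := \row_i F@_(Lmon i).
Definition Lpoly d (w : 'rV[k]_(Ldim d)) : {mpoly k[n.+1]} :=
  \sum_i w 0 i *: 'X_[Lmon i].

Lemma Lmon_deg d (i : 'I_(Ldim d)) : mdeg (Lmon i) = d.
Proof. by have := enum_valP i; rewrite inE => /andP[/eqP]. Qed.

Lemma Lmon_off d (i : 'I_(Ldim d)) : off_plane (Lmon i).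
Proof. by have := enum_valP i; rewrite inE => /andP[]. Qed.

Lemma Lpoly_homog d (w : 'rV_(Ldim d)) : Lpoly w \is d.-homog.
Proof. by apply: rpred_sum => i _; apply: dhomogZ; rewrite dhomogX /= Lmon_deg. Qed.

Lemma Lpoly_Lambda d (w : 'rV_(Ldim d)) : in_ideal_Lambda (Lpoly w).
Proof. by apply: in_ideal_sum => i _; apply/in_idealZ/in_LambdaX/Lmon_off. Qed.

Lemma LrowK d F : F \is d.-homog -> in_ideal_Lambda F -> Lpoly (Lrow d F) = F.
Proof.
move=> hF /in_LambdaP FL; have sF : (msize F <= d.+1)%N.
  by rewrite msizeE; apply/bigmax_leqP_seq => m /(dhomog_mf hF) /= ->.
rewrite [RHS](mpolywE sF) (bigID (mem (Lmons d))) /= [X in _ + X]big1.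
  rewrite addr0 [RHS]big_enum_val; apply: eq_bigr => i _; rewrite mxE //.
move=> m; rewrite inE => mL; apply/eqP; rewrite scaler_eq0; apply/orP; left.
apply: contraR mL; rewrite -mcoeff_msupp => mF.
by rewrite FL // (dhomog_mf hF mF) /= eqxx.
Qed.

Lemma LpolyK d : cancel (@Lpoly d) (Lrow d).
Proof.
move=> w; apply/rowP => i; rewrite mxE raddf_sum (bigD1 i) //= mcoeffZ mcoeffX.
rewrite eqxx mulr1 big1 ?addr0 // => j ji; rewrite mcoeffZ mcoeffX.
by rewrite (inj_eq val_inj) (inj_eq enum_val_inj) (negPf ji) mulr0.
Qed.

Lemma LpolyD d (v w : 'rV_(Ldim d)) : Lpoly (v + w) = Lpoly v + Lpoly w.
Proof. by rewrite -big_split; apply: eq_bigr => i _; rewrite mxE scalerDl. Qed.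

Lemma LpolyZ d c (w : 'rV_(Ldim d)) : Lpoly (c *: w) = c *: Lpoly w.
Proof. by rewrite scaler_sumr; apply: eq_bigr => i _; rewrite mxE scalerA. Qed.

Lemma Lpoly_sum d (I : finType) (w : I -> 'rV_(Ldim d)) :
  Lpoly (\sum_i w i) = \sum_i Lpoly (w i).
Proof.
apply: (big_morph (@Lpoly d) (@LpolyD d)).
by rewrite /Lpoly big1 // => i _; rewrite mxE scale0r.
Qed.

Lemma LrowD d F G : Lrow d (F + G) = Lrow d F + Lrow d G.
Proof. by apply/rowP=> i; rewrite !mxE mcoeffD. Qed.

Lemma LrowZ d c F : Lrow d (c *: F) = c *: Lrow d F.
Proof. by apply/rowP=> i; rewrite !mxE mcoeffZ. Qed.

Lemma Lrow_sum d (I : Type) (s : seq I) (F : I -> {mpoly k[n.+1]}) :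
  Lrow d (\sum_(i <- s) F i) = \sum_(i <- s) Lrow d (F i).
Proof.
apply: (big_morph (Lrow d) (@LrowD d)).
by apply/rowP=> i; rewrite !mxE mcoeff0.
Qed.

Lemma mmap_Lpoly d (w : 'rV_(Ldim d)) (A : comNzRingType)
    (phi : {rmorphism k -> A}) x :
  mmap phi x (Lpoly w) = \sum_i phi (w 0 i) * mmap1 x (Lmon i).
Proof. by rewrite raddf_sum; apply: eq_bigr => i _ /=; rewrite mmapZ mmapX. Qed.

(** In degree at least 2 a monomial of the ideal of the plane can lose one
    variable and stay in the ideal. *)
Lemma in_Lambda_split d F : F \is d.+1.-homog -> in_ideal_Lambda F -> (0 < d)%N ->
  exists G : 'I_n.+1 -> {mpoly k[n.+1]},
    [/\ forall j, G j \is d.-homog, forall j, in_ideal_Lambda (G j)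
      & F = \sum_j 'X_j * G j].
Proof.
move=> hF FL d0; rewrite -(LrowK hF FL) /Lpoly.
elim/big_ind: _ => [|_ _ [G [G1 G2 ->]] [H [H1 H2 ->]]|i _].
- exists (fun=> 0); split=> [j|j|]; [exact: dhomog0 | exact: in_ideal0 |].
  by rewrite big1 // => j _; rewrite mulr0.
- exists (fun j => G j + H j); split=> [j|j|]; first exact: rpredD.
    exact: in_idealD (G2 j) (H2 j).
  by rewrite -big_split; apply: eq_bigr => j _; rewrite mulrDr.
have [a [m [E da dm mL]]] : exists a m,
    [/\ Lmon i = (U_(a) + m)%MM, mdeg U_(a) = 1%N, mdeg m = d & off_plane m].
  have /existsP[j /andP[j3 mj]] := Lmon_off i.
  have Ej : (Lmon i = U_(j) + (Lmon i - U_(j)))%MM.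
    by rewrite addmC submK // lep1mP.
  have : mdeg (Lmon i - U_(j)) = (1 + d.-1)%N.
    by have := congr1 mdeg Ej; rewrite mdegD mdeg1 Lmon_deg; lia.
  case/mnm_split=> m1 [m2 [E /eqP/mdeg1P[a /eqP m1a] d2]].
  exists a, (m2 + U_(j))%MM; split; last 1 first.
  - by apply/off_planeD/existsP; exists j; rewrite j3 mnm1E eqxx.
  - by rewrite Ej E m1a addmC addmA.
  - by rewrite mdeg1.
  - by rewrite mdegD mdeg1 d2; lia.
exists (fun j => if j == a then Lrow d.+1 F 0 i *: 'X_[m] else 0); split=> [j|j|].
- by case: eqP => _; [rewrite dhomogZ // dhomogX /= dm | exact: dhomog0].
- by case: eqP => _; [exact/in_idealZ/in_LambdaX | exact: in_ideal0].
rewrite (bigD1 a) //= eqxx big1 ?addr0 => [|j /negPf->]; last by rewrite mulr0.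
by rewrite E mpolyXD -scalerAr.
Qed.

End Lambda.

(** * Prescribing the values of forms at closed points *)

Section ClosedPoint.
Variables (k : fieldType) (n : nat) (p : closed_point k n).
Local Notation L := (resfield p).
Local Notation c := (@coord_of k n p).
Implicit Types (F G : {mpoly k[n.+1]}).

Lemma eval_atX j : eval_at 'X_j c = c j.
Proof. by rewrite /eval_at mmapX mmap1U. Qed.

Section Reach.
Variables (l : 'I_n.+1) (cl : c l != 0).

(** The values at p of the regular functions on the chart x_l != 0 ; they form a
    subring of k(p), shown below to be a field containing its generators. *)
Let reach (e : L) := exists d F, F \is d.-homog /\ eval_at F c = e * c l ^+ d.

Let reach_at (e : L) d := exists F, F \is d.-homog /\ eval_at F c = e * c l ^+ d.

Let reach_up e d d' : reach_at e d -> reach_at e (d + d').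
Proof.
case=> F [hF Fc]; exists (F * 'X_l ^+ d'); split.
  exact/dhomogM2/dhomogXn.
rewrite /eval_at rmorphM rmorphXn /= -!/(eval_at _ c) Fc eval_atX.
by rewrite exprD mulrA.
Qed.

Let reachD e e' : reach e -> reach e' -> reach (e + e').
Proof.
case=> d /reach_up h [d' /reach_up h']; exists (d + d')%N.
have [F [hF Fc]] := h d'; have [F' [hF' Fc']] := h' d.
exists (F + F'); split; first by rewrite addnC in hF'; apply: dhomogD.
by rewrite /eval_at rmorphD /= -!/(eval_at _ c) Fc Fc' (addnC d') mulrDl.
Qed.

Let reachM e e' : reach e -> reach e' -> reach (e * e').
Proof.
case=> d [F [hF Fc]] [d' [F' [hF' Fc']]]; exists (d + d')%N, (F * F').
split; first exact: dhomogM2.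
rewrite /eval_at rmorphM /= -!/(eval_at _ c) Fc Fc' exprD; ring.
Qed.

Let reachC a : reach (a%:A).
Proof.
exists 0%N, a%:MP; split; last by rewrite /eval_at mmapC expr0 mulr1.
by rewrite -[_%:MP]mulr1 mul_mpolyC; apply/dhomogZ/dhomog1.
Qed.

Let reachX j : reach (c j / c l).
Proof.
exists 1%N, 'X_j; rewrite dhomogX /= mdeg1 eval_atX expr1 divfK //.
Qed.

Let reach_horner (q : {poly L}) x :
  (forall i, reach q`_i) -> reach x -> reach q.[x].
Proof.
move=> hq hx; rewrite horner_coef; elim/big_ind: _ => [|y z|i _].
- by rewrite -(scale0r 1); apply: reachC.
- exact: reachD.
apply: reachM => //; elim: (i : nat) => [|m IH].
  by rewrite expr0 -(scale1r 1); apply: reachC.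
by rewrite exprS; apply: reachM.
Qed.

Let reachV x : reach x -> reach x^-1.
Proof.
move=> hx; have : x^-1 \in <<1; x>>%VS by rewrite memvV memv_adjoin.
case/Fadjoin1_polyP=> q ->; apply: reach_horner => // i.
by rewrite coef_map; apply: reachC.
Qed.

Let reach_adjoin (s : seq L) (K : {subfield L}) :
  (forall x, x \in K -> reach x) -> (forall x, x \in s -> reach x) ->
  forall x, x \in <<K & s>>%VS -> reach x.
Proof.
elim: s K => [|y s IH] K hK hs x; first by rewrite Fadjoin_nil; apply: hK.
rewrite adjoin_cons; apply: (IH <<K; y>>%AS) => [z|z zs]; last first.
  by apply: hs; rewrite inE zs orbT.
case/Fadjoin_polyP=> q /polyOverP hq ->; apply: reach_horner => [i|].
  exact: hK.
by apply: hs; rewrite mem_head.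
Qed.

Let reach_all e : reach e.
Proof.
have := memvf e; rewrite -(coord_gen p).
apply: (@reach_adjoin _ 1%AS) => [x /vlineP[a ->]|x]; first exact: reachC.
case/allpairsP=> [[i j] [_ _ ->]] /=.
have -> : c i / c j = (c i / c l) * (c j / c l)^-1.
  by rewrite invfM invrK mulrACA mulVf // mulr1.
exact/reachM/reachV.
Qed.

Lemma evaluation_onto_chart :
  exists d0, forall d, (d0 <= d)%N -> forall e : L,
    exists F, F \is d.-homog /\ eval_at F c = e.
Proof.
pose b (i : 'I_(\dim {:L})) := (vbasis {:L})`_i.
have [D hD] := fin_all_exists (fun i => reach_all (b i)).
exists (\max_i D i) => d leDd e.
have hb i : reach_at (b i) d.
  have : (D i <= d)%N by apply: leq_trans leDd; apply: leq_bigmax.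
  by move/subnKC <-; apply/reach_up/hD.
have [F hF] := fin_all_exists hb.
have ed : e / c l ^+ d \in <<vbasis {:L}>>%VS.
  by rewrite (span_basis (vbasisP _)) memvf.
exists (\sum_i coord (vbasis {:L}) i (e / c l ^+ d) *: F i); split.
  by apply: rpred_sum => i _; apply: dhomogZ; case: (hF i).
rewrite /eval_at raddf_sum /=.
under eq_bigr => i _ do rewrite mmapZ -/(eval_at _ c) (hF i).2 mulrA mulr_algl.
by rewrite -mulr_suml -(coord_span ed) divfK // expf_neq0.
Qed.
End Reach.

(** The ratios of coordinates generate k(p) as an algebra and not only as a
    field, the inverse of an algebraic element being a polynomial in it; and
    finitely many numerators suffice, k(p) being finite over k. *)
Lemma evaluation_onto :
  exists d0, forall d, (d0 <= d)%N -> forall e : L,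
    exists F, F \is d.-homog /\ eval_at F c = e.
Proof. by have [l cl] := coord_neq0 p; apply: evaluation_onto_chart cl. Qed.

End ClosedPoint.

Section Points.
Variables (k : fieldType) (n : nat).
Implicit Types (F G : {mpoly k[n.+1]}) (p q : closed_point k n).

(** Homogeneous prime ideals of closed points are maximal among relevant ones,
    hence there is no proper inclusion between them: a form G vanishing at p
    and not at q would have an inverse H at q, and x_l^d - G H, which vanishes
    at q, would not vanish at p. *)
Lemma separating_form p q : ~ same_point p q ->
  exists d F, [/\ F \is d.-homog, vanishes_at F q & ~ vanishes_at F p].
Proof.
move=> pq; apply: contrapT => hn.
have qp d F : F \is d.-homog -> vanishes_at F q -> vanishes_at F p.
  by move=> hF Fq; apply: contrapT => nF; apply: hn; exists d, F.
apply: pq => d G hG; split=> [Gp|]; last exact: qp hG.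
apply: contrapT => Gq; have /eqP Gq0 : eval_at G (@coord_of k n q) != 0.
  exact/eqP.
have [d0 onto] := evaluation_onto q.
have [l pl] := coord_neq0 p.
have ql : coord_of q l != 0.
  apply: contraNneq pl => ql; have : vanishes_at 'X_l p.
    by apply: (@qp 1%N); rewrite ?dhomogX /= ?mdeg1 // /vanishes_at eval_atX.
  by rewrite /vanishes_at eval_atX => ->.
have [H [hH Hq]] := onto d0 (leqnn _)
   (coord_of q l ^+ (d + d0) / eval_at G (@coord_of k n q)).
have : vanishes_at ('X_l ^+ (d + d0) - G * H) p.
  apply: (@qp (d + d0)%N).
    by apply: rpredB; [exact: dhomogXn | exact: dhomogM2].
  rewrite /vanishes_at /eval_at rmorphB rmorphM rmorphXn /= -!/(eval_at _ _).
  by rewrite eval_atX Hq mulrC divfK ?subrr //; apply/eqP.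
rewrite /vanishes_at /eval_at rmorphB rmorphM rmorphXn /= -!/(eval_at _ _).
rewrite Gp mul0r subr0 eval_atX => /eqP.
by rewrite expf_eq0 (negPf pl) andbF.
Qed.

Section Separation.
Variables (r : nat) (p : 'I_r -> closed_point k n).
Hypothesis distinct : forall i j, same_point (p i) (p j) -> i = j.
Hypothesis disjoint : forall i, ~ on_Lambda (p i).

(** The product of forms separating p_i from the other points, times a coordinate
    x_l with l >= 3 that does not vanish at p_i. *)
Lemma isolating_form i : exists d F,
  [/\ F \is d.-homog, in_ideal_Lambda F, ~ vanishes_at F (p i)
    & forall j, j != i -> vanishes_at F (p j)].
Proof.
have [l /not_implyP [l3 pl]] : exists l : 'I_n.+1,
    ~ ((3 <= l)%N -> coord_of (p i) l = 0).
  by apply: contrapT => hn; apply: (disjoint (i := i)) => l l3;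
     apply: contrapT => pl; apply: hn; exists l => /(_ l3).
have sep j : exists dF : nat * {mpoly k[n.+1]}, [/\ dF.2 \is dF.1.-homog,
    ~ vanishes_at dF.2 (p i) & j != i -> vanishes_at dF.2 (p j)].
  have [->|ji] := eqVneq j i.
    exists (0%N, 1); split=> //; first exact: dhomog1.
    by rewrite /vanishes_at /eval_at rmorph1; apply/eqP/oner_neq0.
  have [|d [F [hF Fj Fi]]] := @separating_form (p i) (p j).
    by move/distinct => ij; rewrite ij eqxx in ji.
  by exists (d, F).
have [dF hdF] := fin_all_exists sep.
exists (1 + \sum_j (dF j).1)%N, ('X_l * \prod_j (dF j).2); split.
- apply: dhomogM2; first by rewrite dhomogX /= mdeg1.
  apply: (big_rec2 (fun d G => G \is [in k[n.+1], d.-homog])).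
    exact: dhomog1.
  by move=> j d G _ hG; apply: dhomogM2 => //; case: (hdF j).
- by rewrite mulrC; apply/in_idealMl/(@in_ideal_gen _ _ _ _ (fun j => 'X_j)).
- rewrite /vanishes_at /eval_at rmorphM rmorph_prod /= -/(eval_at _ _) eval_atX.
  apply/eqP; rewrite mulf_neq0 //; first exact/eqP.
  by apply/prodf_neq0 => j _; apply/eqP; case: (hdF j).
move=> j ji; have [_ _ /(_ ji)] := hdF j.
rewrite /vanishes_at /eval_at => Fj.
by rewrite rmorphM rmorph_prod /= (bigD1 j) //= Fj mul0r mulr0.
Qed.

(** An isolating form at each point carries the value to prescribe there,
    corrected by a form taking a suitable value in k(p). *)
Lemma interpolation : exists d1, forall d, (d1 <= d)%N ->
  forall e : (forall i, resfield (p i)), exists F,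
    [/\ F \is d.-homog, in_ideal_Lambda F
      & forall i, eval_at F (@coord_of k n (p i)) = e i].
Proof.
have [D hD] := fin_all_exists isolating_form.
have [F hF] := fin_all_exists hD.
have [D' hD'] := fin_all_exists (fun i => evaluation_onto (p i)).
exists (\sum_i (D i + D' i))%N => d led e.
have ledi i : (D i + D' i <= d)%N.
  by apply: leq_trans led; rewrite (bigD1 i) //= leq_addr.
have hG i : exists G, G \is (d - D i).-homog /\
    eval_at G (@coord_of k n (p i)) = e i / eval_at (F i) (@coord_of k n (p i)).
  by apply: hD'; have := ledi i; lia.
have [G {}hG] := fin_all_exists hG.
exists (\sum_i G i * F i); split.
- apply: rpred_sum => i _; have [hFi _ _ _] := hF i; have [hGi _] := hG i.
  have <- : (d - D i + D i = d)%N by have := ledi i; lia.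
  exact: dhomogM2.
- by apply: in_ideal_sum => i _; apply: in_idealMl; case: (hF i).
move=> i; rewrite /eval_at raddf_sum (bigD1 i) //= rmorphM /= big1 => [|j ji].
  have [_ _ /eqP Fi _] := hF i; have [_ Gi] := hG i; move: Gi.
  by rewrite /eval_at => ->; rewrite addr0 divfK.
have [_ _ _ Fj] := hF j; move: (Fj i); rewrite eq_sym => /(_ ji).
by rewrite /vanishes_at /eval_at rmorphM /= => ->; rewrite mulr0.
Qed.

End Separation.
End Points.

(** * The equations cut out Lambda and Gamma in large degrees *)

Section Residual.
Variables (k : fieldType) (n : nat) (r : nat) (p : 'I_r -> closed_point k n).
Implicit Types (F G : {mpoly k[n.+1]}).

(** A k-basis of the coordinate ring of Gamma. *)
Definition gamma_index := {i : 'I_r & 'I_(\dim {:resfield (p i)})}.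

Lemma card_gamma_index : #|{: gamma_index}| = degree_count p.
Proof.
rewrite card_tagged sumnE big_map big_enum /=; apply: eq_bigr => i _.
exact: card_ord.
Qed.

Definition gamma_coord (s : gamma_index) (x : resfield (p (tag s))) : k :=
  coord (vbasis {:resfield (p (tag s))}) (tagged s) x.

(** The matrix of the evaluation map from the forms of degree d vanishing on the
    plane to the coordinate ring of Gamma. *)
Definition gamma_mx d : 'M[k]_(Ldim n d, #|{: gamma_index}|) :=
  \matrix_(m, s) gamma_coord (mmap1 (@coord_of k n (p (tag (enum_val s)))) (Lmon m)).

Lemma gamma_mxE d (w : 'rV_(Ldim n d)) s :
  (w *m gamma_mx d) 0 s = gamma_coord (eval_at (Lpoly w) (@coord_of k n (p (tag (enum_val s))))).
Proof.
rewrite mxE /eval_at mmap_Lpoly /gamma_coord raddf_sum; apply: eq_bigr => i _.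
by rewrite mxE /gamma_coord /= mulr_algl linearZ.
Qed.

Lemma gamma_coord_eq0 i (x : resfield (p i)) :
  (forall j, gamma_coord (s := Tagged _ j) x = 0) -> x = 0.
Proof.
move=> x0; rewrite (coord_basis (vbasisP _) (memvf x)).
by rewrite big1 // => j _; have := x0 j; rewrite /gamma_coord /= => ->; rewrite scale0r.
Qed.

Lemma gamma_kernel d (w : 'rV_(Ldim n d)) :
  w *m gamma_mx d = 0 <-> forall i, vanishes_at (Lpoly w) (p i).
Proof.
split=> [w0 i|w0]; last first.
  by apply/rowP => s; rewrite gamma_mxE w0 /gamma_coord mxE linear0.
apply: gamma_coord_eq0 => j.
have := gamma_mxE w (enum_rank (Tagged (fun i => 'I_(\dim {:resfield (p i)})) j)).
by rewrite enum_rankK w0 mxE.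
Qed.

Variable (Q : 'I_n -> {mpoly k[n.+1]}).
Hypothesis Qp : is_residual Q p.

Definition residual_form d F :=
  [/\ F \is d.-homog, in_ideal_Lambda F & forall i, vanishes_at F (p i)].

Local Notation in_Q := (in_ideal predT Q).

(** The residual forms of degree e have a finite basis, read off from the kernel
    of the evaluation matrix, so the exponents of saturation are bounded. *)
Lemma saturation_uniform e : exists N, forall F, residual_form e F ->
  forall m, (N <= mdeg m)%N -> in_Q ('X_[m] * F).
Proof.
pose ker a := Lpoly (row a (kermx (gamma_mx e))).
have sat a : in_saturation Q (ker a).
  apply/(residual_scheme Qp (Lpoly_homog _)); split; first exact: Lpoly_Lambda.
  by apply/gamma_kernel; rewrite -row_mul mulmx_ker row0.
have [N hN] := fin_all_exists sat.
exists (\max_a N a) => F [hF FL Fp] m leNm.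
have /sub_kermxP/submxP[y Fy] : Lrow e F *m gamma_mx e = 0.
  by apply/gamma_kernel; rewrite LrowK.
rewrite -(LrowK hF FL) Fy mulmx_sum_row Lpoly_sum mulr_sumr.
apply: in_ideal_sum => a _; rewrite LpolyZ -scalerAr; apply: in_idealZ.
have leNa : (N a <= mdeg m)%N by apply: leq_trans leNm; apply: leq_bigmax.
have [m1 [m2 [-> _ d2]]] : exists m1 m2,
    [/\ m = (m1 + m2)%MM, mdeg m1 = (mdeg m - N a)%N & mdeg m2 = N a].
  by apply: mnm_split; rewrite subnK.
by rewrite mpolyXD -mulrA; apply/in_idealMl/hN.
Qed.

(** With u a form of degree d2 vanishing on the plane and equal to 1 on Gamma,
    every residual form of large degree is a combination of residual forms of
    lower degree: write it as the sum of the x_j G_j, and subtract from each G_j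
    a multiple of u with the same values on Gamma. So the residual forms are
    generated in bounded degrees, where finitely many of them span, and a single
    exponent of saturation suffices. *)
Lemma residual_form_in_ideal :
  exists d0, forall d F, (d0 <= d)%N -> residual_form d F -> in_Q F.
Proof.
have [d1 interp] := interpolation (residual_distinct Qp) (residual_disjoint Qp).
(* d2 > 0 makes the degree drop when u is factored out *)
have [d2 [d2_gt0 {d1}interp]] : exists d2, (0 < d2)%N /\ forall d, (d2 <= d)%N ->
  forall e : (forall i, resfield (p i)), exists F,
    [/\ F \is d.-homog, in_ideal_Lambda F
      & forall i, eval_at F (@coord_of k n (p i)) = e i].
  by exists d1.+1; split=> // d led; apply/interp/ltnW.
have [u [hu uL u1]] := interp d2 (leqnn _) (fun=> 1).
have [N hN] := fin_all_exists (fun e : 'I_(d2 + d2).+1 => saturation_uniform e).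
pose M := \max_e N e.
suff main d : forall F, residual_form d F -> forall m,
    (M + (d2 + d2) <= mdeg m + d)%N -> in_Q ('X_[m] * F).
  exists (M + (d2 + d2))%N => d F led hF; rewrite -[F]mul1r -mpolyX0.
  by apply: main hF _ _; rewrite mdeg0.
elim/ltn_ind: d => d IH F hF m led.
have [small|] := leqP d (d2 + d2).
  apply: (hN (Ordinal (small : (d < (d2 + d2).+1)%N))) => //=.
  apply: leq_trans (_ : M <= _)%N; first exact: leq_bigmax.
  by lia.
case: d => // d in IH hF led * => large; have [homF FL Fp] := hF.
have [|G [hG GL FG]] := in_Lambda_split homF FL; first by lia.
have hv j : exists v, [/\ v \is (d - d2).-homog, in_ideal_Lambda v & forall i,
    eval_at v (@coord_of k n (p i)) = eval_at (G j) (@coord_of k n (p i))].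
  by apply: (interp _ _ (fun i => eval_at (G j) (@coord_of k n (p i)))); lia.
have [v {}hv] := fin_all_exists hv.
(* v j takes the same values as G j on Gamma, in degree d - d2 *)
have resG j : residual_form d (G j - u * v j).
  have [vh vL vp] := hv j; split.
  - have led2 : (d2 <= d)%N by lia.
    by apply: dhomogB; rewrite // -(subnKC led2); apply: dhomogM2.
  - exact: in_idealB (GL j) (in_idealMl _ vL).
  move=> i; rewrite /vanishes_at /eval_at rmorphB rmorphM /= -!/(eval_at _ _).
  by rewrite u1 vp mul1r subrr.
have resV : residual_form (1 + (d - d2)) (\sum_j 'X_j * v j).
  split.
  - apply: rpred_sum => j _; have [vh _ _] := hv j.
    by apply: dhomogM2; rewrite // dhomogX /= mdeg1.
  - by apply: in_ideal_sum => j _; have [_ vL _] := hv j; apply: in_idealMl vL.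
  move=> i; rewrite /vanishes_at -[RHS](Fp i) FG /eval_at !rmorph_sum /=.
  apply: eq_bigr => j _.
  by rewrite !rmorphM /= -!/(eval_at _ _); have [_ _ ->] := hv j.
have -> : F = \sum_j 'X_j * (G j - u * v j) + u * \sum_j 'X_j * v j.
  rewrite FG mulr_sumr -big_split; apply: eq_bigr => j _ /=; ring.
rewrite mulrDr mulr_sumr; apply: in_idealD.
  apply: in_ideal_sum => j _; rewrite mulrA -mpolyXD.
  by apply: IH (resG j) _ _ => //; rewrite mdegD mdeg1; lia.
rewrite mulrA -(LrowK hu uL) [X in X * _]mulr_sumr mulr_suml.
apply: in_ideal_sum => i _; rewrite -scalerAr -scalerAl -mpolyXD.
apply: in_idealZ; apply: IH resV _ _; first by lia.
by rewrite mdegD Lmon_deg; lia.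
Qed.

End Residual.

(** * A rank inequality under specialization *)

Section RankDeformation.
Variable k : fieldType.

Lemma det_thin_mulmx (R : idomainType) m l (A : 'M[R]_(m, l)) (B : 'M_(l, m)) :
  (l < m)%N -> \det (A *m B) = 0.
Proof.
move=> lt_lm; apply/eqP; rewrite -tofrac_eq0 -det_map_mx map_mxM.
apply: contraTT lt_lm => det_neq0; rewrite -leqNgt.
have /mxrank_unit <- : map_mx (@tofrac R) A *m map_mx (@tofrac R) B \in unitmx.
  by rewrite unitmxE unitfE.
exact: mulmx_max_rank.
Qed.

Lemma dvdp_det_sub m (d : {poly k}) (A B : 'M_m) :
  (forall i j, d %| A i j - B i j) -> d %| \det A - \det B.
Proof.
move=> hAB; rewrite /determinant -sumrB; elim/big_ind: _ => [|p q|s _].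
- exact: dvdp0.
- exact: dvdp_add.
rewrite -mulrBr; apply: dvdp_mull.
elim/big_rec2: _ => [|i q p _ hpq]; first by rewrite subrr dvdp0.
set a := A _ _; set b := B _ _.
have -> : a * p - b * q = a * (p - q) + (a - b) * q by ring.
by apply: dvdp_add; [apply: dvdp_mull | apply/dvdp_mulr/hAB].
Qed.

(** Were a + D larger than l, the product of the block matrices (P ; Y) and
    (Z | La) would be singular. Modulo t^N it is block triangular, so that t^N
    divides det (P Z) det (Y La); the second factor is 1 at t = 0, so t^N divides
    det (P Z) for all N. But det (P Z) is 1 at t = 1. Here the rows of P are
    the elements of a moving subspace, and the columns of La functionals killing
    them to high order at t = 0. *)
Lemma rank_deformation a l D (P : 'M[{poly k}]_(a, l)) (Y : 'M[k]_(D, l))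
    (Z : 'M[k]_(l, a)) :
  map_mx (horner_eval 1) P *m Z = 1%:M ->
  (forall N, exists La : 'M[{poly k}]_(l, D),
     (forall i j, 'X^N %| (P *m La) i j) /\
     Y *m map_mx (horner_eval 0) La = 1%:M) ->
  (a + D <= l)%N.
Proof.
move=> PZ hLa; rewrite leqNgt; apply/negP => thin.
pose Zp := map_mx polyC Z; pose Yp := map_mx polyC Y.
have evC m1 m2 (x : k) (M : 'M_(m1, m2)) : map_mx (horner_eval x) (map_mx polyC M) = M.
  by apply/matrixP=> i j; rewrite !mxE /horner_eval hornerC.
(* an order exceeding the degree of det (P Z) *)
have [La [PLa YLa]] := hLa (size (\det (P *m Zp))).
have YLa_coprime : coprimep 'X (\det (Yp *m La)).
  rewrite coprimep_sym coprimepX rootE.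
  have -> : (\det (Yp *m La)).[0] = horner_eval 0 (\det (Yp *m La)) by [].
  by rewrite -det_map_mx map_mxM /= evC YLa det1 oner_eq0.
have PZ_neq0 : \det (P *m Zp) != 0.
  have : horner_eval 1 (\det (P *m Zp)) = 1.
    by rewrite -det_map_mx map_mxM /= evC PZ det1.
  by apply: contra_eq_neq => ->; rewrite /horner_eval horner0 eq_sym oner_eq0.
have := det_thin_mulmx (col_mx P Yp) (row_mx Zp La) thin.
rewrite mul_col_row => det0.
have : 'X^(size (\det (P *m Zp))) %| \det (P *m Zp) * \det (Yp *m La).
  rewrite -(det_lblock _ (Yp *m Zp)) -[X in _ %| X]subr0 -[X in _ - X]det0.
  apply: dvdp_det_sub => i j.
  rewrite /block_mx !mxE; case: (split i) => i'; rewrite ![row_mx _ _ _ _]mxE.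
    by case: (split j) => j'; rewrite ?subrr ?dvdp0 // [X in X - _]mxE sub0r dvdpNr.
  by case: (split j) => j'; rewrite subrr dvdp0.
rewrite Gauss_dvdpl ?coprimep_expl // => /(dvdp_leq PZ_neq0).
by rewrite size_polyXn ltnn.
Qed.

End RankDeformation.

(** * Lifting the points of Gamma along a pencil *)

Section Quadric.
Variables (k : fieldType) (n : nat).

(** B is the polar form of F; the second identity is Euler's relation. *)
Lemma quadric_taylor (F : {mpoly k[n]}) : F \is 2.-homog ->
  exists B : 'I_n -> 'I_n -> k,
    forall (A : comNzRingType) (phi : {rmorphism k -> A}) (x v : 'I_n -> A) (e : A),
      mmap phi (fun j => x j + e * v j) F =
        mmap phi x F + e * (\sum_a \sum_b v a * (phi (B a b) * x b))
        + e ^+ 2 * mmap phi v F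
      /\ \sum_a \sum_b x a * (phi (B a b) * x b) = mmap phi x F *+ 2.
Proof.
case/quadric_matrix => q hq; exists (fun a b => q a b + q b a) => A phi x v e.
have polar (y z : 'I_n -> A) : \sum_a \sum_b z a * (phi (q a b + q b a) * y b) =
    \sum_a \sum_b phi (q a b) * (z a * y b + y a * z b).
  rewrite (eq_bigr (fun a => \sum_b phi (q a b) * (z a * y b)
                             + \sum_b phi (q b a) * (z a * y b))) => [|a _].
    rewrite big_split /= [X in _ + X]exchange_big -big_split; apply: eq_bigr => a _.
    by rewrite -big_split; apply: eq_bigr => b _ /=; ring.
  by rewrite -big_split; apply: eq_bigr => b _; rewrite rmorphD /=; ring.
rewrite !polar !hq; split.
  rewrite !mulr_sumr -!big_split; apply: eq_bigr => a _ /=.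
  by rewrite !mulr_sumr -!big_split; apply: eq_bigr => b _ /=; ring.
rewrite -sumrMnl; apply: eq_bigr => a _; rewrite -sumrMnl; apply: eq_bigr => b _.
by rewrite -mulr2n mulrnAr.
Qed.

End Quadric.

Section Lifting.
Variables (k : fieldType) (n : nat) (r : nat) (p : 'I_r -> closed_point k n).
Variables (Q : 'I_n -> {mpoly k[n.+1]}).
Hypothesis Q_quadrics : quadrics_through_Lambda Q.
Hypothesis Qp : is_residual Q p.
Variable i : 'I_r.
Local Notation L := (resfield (p i)).
Local Notation c := (@coord_of k n (p i)).
Local Notation phi := (GRing.in_alg L).
Local Notation phit := (polyC \o GRing.in_alg L).
Implicit Types (F G : {mpoly k[n.+1]}).

(** The derivative at t = 0 of this restriction to the line c + t v is the
    differential of F at p in the direction v. *)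
Let along (v : 'I_n.+1 -> L) F : {poly L} :=
  mmap phit (fun j => (c j)%:P + 'X * (v j)%:P) F.

Lemma mmap_polyC (x : 'I_n.+1 -> L) F :
  mmap phit (fun j => (x j)%:P) F = (eval_at F x)%:P.
Proof. by rewrite /eval_at [RHS]mmap_map. Qed.

Let along0 v F : (along v F).[0] = eval_at F c.
Proof.
rewrite -/(horner_eval 0 _) /along mmap_map; apply: mmap_ext => [a|j] /=.
  by rewrite /horner_eval hornerC.
by rewrite /horner_eval !hornerE.
Qed.

Let alongM v F G : along v (F * G) = along v F * along v G.
Proof. exact: rmorphM. Qed.

Let along_sum v m (F : 'I_m -> {mpoly k[n.+1]}) :
  along v (\sum_a F a) = \sum_a along v (F a).
Proof. exact: raddf_sum. Qed.

Let equations_vanish a : eval_at (Q a) c = 0.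
Proof.
have [Qh QL] := Q_quadrics a.
suff /(residual_scheme Qp Qh)[_] : in_saturation Q (Q a) by apply.
by exists 0%N => m _; apply/in_idealMl/in_ideal_gen.
Qed.

(** Gamma is reduced at p and away from the plane, so a vector killed by the
    differentials of the equations at p is killed by the differential of every
    form G vanishing at p: multiply G by a form isolating p and by a power of a
    coordinate to land in the ideal of the equations. *)
Let tangent v : (forall a, (along v (Q a))^`().[0] = 0) ->
  forall d G, G \is d.-homog -> eval_at G c = 0 -> (along v G)^`().[0] = 0.
Proof.
move=> vQ d G hG Gc.
have [e [F [hF FL Fi Fj]]] :=
  isolating_form (residual_distinct Qp) (residual_disjoint Qp) i.
have hGF : G * F \is (d + e).-homog by apply: dhomogM2.
have [N satN] : in_saturation Q (G * F).
  apply/(residual_scheme Qp hGF); split=> [|j]; first exact: in_idealMl FL.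
  rewrite /vanishes_at /eval_at rmorphM /= -!/(eval_at _ _).
  have [->|ji] := eqVneq j i; first by rewrite Gc mul0r.
  by have := Fj j ji; rewrite /vanishes_at => ->; rewrite mulr0.
have [l cl] := coord_neq0 (p i).
have [|h E] := satN (U_(l) *+ N)%MM; first by rewrite mdegMn mdeg1 mul1n.
have := congr1 (fun A => (along v A)^`().[0]) E.
have -> : (along v (\sum_a h a * Q a))^`().[0] = 0.
  rewrite along_sum (raddf_sum (@deriv L)) horner_sum big1 // => a _.
  rewrite /= alongM derivM !hornerE !along0 equations_vanish.
  by rewrite vQ !mulr0 addr0.
rewrite mulrC -mulrA alongM derivM !hornerE !along0 Gc mul0r addr0 /eval_at.
rewrite rmorphM -mpolyXn rmorphXn /=.
rewrite -!/(eval_at _ _) eval_atX => /eqP; rewrite mulf_eq0 => /orP[/eqP-> //|].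
by rewrite mulf_eq0 expf_eq0 (negPf cl) andbF orbF => /eqP/Fi.
Qed.

(** As k(p) is separable over k, such a vector is proportional to p: up to a
    multiple of c its component along a coordinate x_l not vanishing at p is zero,
    and then the differential of the homogenized minimal polynomial of c_j / c_l
    is a nonzero multiple of its component along x_j. *)
Let tangent_eq0 l v : c l != 0 -> v l = 0 ->
  (forall a, (along v (Q a))^`().[0] = 0) -> forall j, v j = 0.
Proof.
move=> cl vl vQ j; set x := c j / c l.
have sep : separable_element 1 x.
  by have /separableP := residual_separable Qp i; apply; apply: memvf.
have [m mE] : exists m : {poly k}, minPoly 1 x = map_poly phi m.
  by have /polyOver1P[m ->] := minPolyOver 1%AS x; exists m.
have mx0 : root (map_poly phi m) x by rewrite -mE root_minPoly.
have mx1 : (map_poly phi m)^`().[x] != 0.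
  by move: sep; rewrite /separable_element mE unlock => cop; apply: coprimep_root cop _.
(* G is the minimal polynomial of x_j / x_l, homogenized *)
pose e := (size m).-1.
have le_be (b : 'I_(size m)) : (b <= e)%N by have := ltn_ord b; lia.
pose G := \sum_(b < size m) m`_b *: ('X_j ^+ b * 'X_l ^+ (e - b)) : {mpoly k[n.+1]}.
have hG : G \is e.-homog.
  apply: rpred_sum => b _; apply: dhomogZ.
  by rewrite -[X in X.-homog](subnKC (le_be b)) dhomogM2 ?dhomogXn.
have GE : along v G = (c l ^+ e)%:P * (map_poly phi m \Po (x%:P + 'X * (v j / c l)%:P)).
  rewrite along_sum comp_polyE size_map_poly mulr_sumr.
  apply: eq_bigr => b _; rewrite /along mmapZ rmorphM !rmorphXn /= !mmapX !mmap1U.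
  rewrite vl mulr0 addr0 coef_map /= -mul_polyC.
  rewrite -{2}(subnK (le_be b)).
  have -> : (c j)%:P + 'X * (v j)%:P = (c l)%:P * (x%:P + 'X * (v j / c l)%:P) :> {poly L}.
    by rewrite mulrDr [_ * ('X * _)]mulrCA -!polyCM /x !(mulrC (c l)) !divfK.
  rewrite exprMn exprD; ring.
have /eqP : (along v G)^`().[0] = 0.
  apply: (tangent vQ hG); rewrite -(along0 v) GE !hornerE horner_comp !hornerE.
  by rewrite (rootP mx0) mulr0.
rewrite GE derivM derivC mul0r add0r deriv_comp !hornerE horner_comp !hornerE.
rewrite derivD derivC derivM derivX derivC !hornerE.
rewrite !mulf_eq0 expf_eq0 (negPf cl) andbF (negPf mx1) invr_eq0 (negPf cl).
by rewrite orbF => /eqP.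
Qed.

(** The kernel of the n x (n + 1) Jacobian matrix at p is the line of c: it
    contains c by Euler's relation, and nothing else by [tangent_eq0]. *)
Let jacobian_onto (B : 'I_n -> 'I_n.+1 -> 'I_n.+1 -> k) :
  (forall a (A : comNzRingType) (f : {rmorphism k -> A}) (x v : 'I_n.+1 -> A) (e : A),
      mmap f (fun j => x j + e * v j) (Q a) =
        mmap f x (Q a) + e * (\sum_b \sum_b' v b * (f (B a b b') * x b'))
        + e ^+ 2 * mmap f v (Q a)
      /\ \sum_b \sum_b' x b * (f (B a b b') * x b') = mmap f x (Q a) *+ 2) ->
  forall w : 'I_n -> L, exists v : 'I_n.+1 -> L,
    forall a, \sum_b \sum_b' v b * (phi (B a b b') * c b') = w a.
Proof.
move=> hB.
pose J : 'M[L]_(n.+1, n) := \matrix_(b, a) \sum_b' phi (B a b b') * c b'.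
have JE (v : 'rV_n.+1) a :
    (v *m J) 0 a = \sum_b \sum_b' v 0 b * (phi (B a b b') * c b').
  by rewrite mxE; apply: eq_bigr => b _; rewrite mxE mulr_sumr.
pose cv : 'rV[L]_n.+1 := \row_j c j.
have cJ : cv *m J = 0.
  apply/rowP => a; rewrite JE mxE -[RHS](mul0rn _ 2) -[in RHS](equations_vanish a).
  rewrite /eval_at -(hB a _ phi c c 0).2.
  by apply: eq_bigr => b _; apply: eq_bigr => b' _; rewrite mxE.
have [l cl] := coord_neq0 (p i).
have ker (v : 'rV_n.+1) : v *m J = 0 -> v = (v 0 l / c l) *: cv.
  (* subtract the multiple of c that makes the component along x_l vanish *)
  move=> vJ; pose v' := v - (v 0 l / c l) *: cv.
  have v'J : v' *m J = 0 by rewrite mulmxBl vJ -scalemxAl cJ scaler0 subrr.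
  have v'l : v' 0 l = 0 by rewrite !mxE divfK // subrr.
  apply/eqP; rewrite -subr_eq0 -/v'; apply/eqP/rowP => j; rewrite [RHS]mxE.
  apply: (@tangent_eq0 l (v' 0) cl v'l) => a; rewrite /along (hB a _ _ _ _ 'X).1.
  rewrite !mmap_polyC.
  set S := \sum_b _; rewrite !(derivD, derivC, derivM, derivX, derivXn) !hornerE /=.
  rewrite !addr0 /S.
  transitivity ((v' *m J) 0 a); last by rewrite v'J mxE.
  rewrite JE horner_sum; apply: eq_bigr => b _; rewrite horner_sum.
  by apply: eq_bigr => b' _; rewrite !hornerE.
have full : row_full J.
  have kerJ : (kermx J <= cv)%MS.
    apply/row_subP => b; rewrite (ker (row b (kermx J))) ?scalemx_sub //.
    by rewrite -row_mul mulmx_ker row0.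
  rewrite /row_full eqn_leq rank_leq_col /=.
  have := leq_trans (mxrankS kerJ) (rank_leq_row cv).
  by rewrite mxrank_ker; have := rank_leq_row J; lia.
move=> w; have /submxP[v vw] := submx_full (\row_a w a) full.
by exists (v 0) => a; rewrite -JE -vw mxE.
Qed.

Variable Q' : 'I_n -> {mpoly k[n.+1]}.
Hypothesis Q'_quadrics : quadrics_through_Lambda Q'.

(** Newton's method along the pencil (1 - t) Q + t Q': as the Jacobian matrix at p
    is onto, p lifts to a solution modulo any power of t. *)
Lemma lift_point N : exists x : 'I_n.+1 -> {poly L},
  (forall j, (x j).[0] = c j) /\
  forall a, 'X^N %| (1 - 'X) * mmap phit x (Q a) + 'X * mmap phit x (Q' a).
Proof.
have [B hB] := fin_all_exists (fun a => quadric_taylor (Q_quadrics a).1).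
have [B' hB'] := fin_all_exists (fun a => quadric_taylor (Q'_quadrics a).1).
case: N => [|N].
  exists (fun j => (c j)%:P); split=> [j|a]; first by rewrite hornerC.
  by rewrite expr0 dvd1p.
elim: N => [|N [x [x0 xN]]].
  exists (fun j => (c j)%:P); split=> [j|a]; first by rewrite hornerC.
  by rewrite mmap_polyC equations_vanish mulr0 add0r expr1 dvdp_mulIl.
have [g hg] := fin_all_exists (fun a => dvdpP _ _ (xN a)).
have [v hv] := jacobian_onto hB (fun a => - (g a).[0]).
exists (fun j => x j + 'X^(N.+1) * (v j)%:P); split=> [j|a].
  by rewrite !hornerE x0 expr0n mul0r addr0.
rewrite (hB a _ phit x (fun j => (v j)%:P) 'X^(N.+1)).1.
rewrite (hB' a _ phit x (fun j => (v j)%:P) 'X^(N.+1)).1.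
set S := \sum_b _; set S' := \sum_b _; set T := mmap _ _ (Q a).
set T' := mmap _ _ (Q' a); set U := mmap _ _ (Q a); set U' := mmap _ _ (Q' a).
have -> : (1 - 'X) * (T + 'X^(N.+1) * S + 'X^(N.+1) ^+ 2 * U)
    + 'X * (T' + 'X^(N.+1) * S' + 'X^(N.+1) ^+ 2 * U')
  = ((1 - 'X) * T + 'X * T') + 'X^(N.+1) * (S - 'X * S + 'X * S' +
     'X^(N.+1) * ((1 - 'X) * U + 'X * U')).
  ring.
rewrite hg mulrC -mulrDr exprSr dvdp_mul2l ?expf_neq0 ?polyX_eq0 //.
(* v was chosen to cancel the coefficient of t^(N+1) *)
have S0 : S.[0] = - (g a).[0].
  rewrite -hv horner_sum; apply: eq_bigr => b _; rewrite horner_sum.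
  by apply: eq_bigr => b' _; rewrite !hornerE x0.
rewrite -[X in X %| _]subr0 -polyC0 dvdp_XsubCl rootE !hornerE S0.
by rewrite expr0n /= !mul0r subrr !addr0 subr0.
Qed.

End Lifting.

(** * Invariance of the number of points *)

Section GammaPoly.
Variables (k : fieldType) (n : nat) (r : nat) (p : 'I_r -> closed_point k n).

Definition gamma_coord_poly (s : gamma_index p) (q : {poly resfield (p (tag s))}) :
  {poly k} := map_poly (@gamma_coord k n r p s) q.

Variable s : gamma_index p.
Local Notation L := (resfield (p (tag s))).
Local Notation gcp := (@gamma_coord_poly s).

Let gamma_coord0 : @gamma_coord k n r p s 0 = 0.
Proof. by rewrite /gamma_coord linear0. Qed.

Lemma coef_gcp q j : (gcp q)`_j = gamma_coord (q`_j).
Proof. exact: coef_map_id0. Qed.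

Lemma gcp_sum (I : finType) (F : I -> {poly L}) : gcp (\sum_i F i) = \sum_i gcp (F i).
Proof.
apply/polyP => j; rewrite coef_gcp !coef_sum /gamma_coord raddf_sum.
by apply: eq_bigr => i _; rewrite coef_gcp.
Qed.

Lemma gcp_linear (f : {poly k}) q : gcp (map_poly (GRing.in_alg L) f * q) = f * gcp q.
Proof.
apply/polyP => j; rewrite coef_gcp !coefM /gamma_coord raddf_sum.
apply: eq_bigr => i _; rewrite coef_gcp coef_map /= mulr_algl.
by rewrite /gamma_coord linearZ.
Qed.

End GammaPoly.

Section Invariance.
Variables (k : fieldType) (n : nat) (Q Q' : 'I_n -> {mpoly k[n.+1]}).
Hypotheses (Q_quadrics : quadrics_through_Lambda Q)
           (Q'_quadrics : quadrics_through_Lambda Q').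
Variables (r r' : nat) (p : 'I_r -> closed_point k n) (p' : 'I_r' -> closed_point k n).
Hypotheses (Qp : is_residual Q p) (Qp' : is_residual Q' p').

Section Degree.
Variable e : nat.
Local Notation d := (e + 2)%N.

Definition mons : {set 'X_{1..n.+1 < e.+1}} := [set m | mdeg (bmnm m) == e].

(** Multiples of the quadrics by the monomials of degree e; they span the part of
    degree e + 2 of the ideal. *)
Definition gen_index := ('I_#|mons| * 'I_n)%type.
Definition gen_mnm (s : gen_index) : 'X_{1..n.+1} := bmnm (enum_val s.1).
Definition gen (R : 'I_n -> {mpoly k[n.+1]}) (s : gen_index) := 'X_[gen_mnm s] * R s.2.
Definition gen_mx : 'M[k]_(#|{: gen_index}|, Ldim n d) :=
  \matrix_s Lrow d (gen Q' (enum_val s)).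

Lemma gen_homog R s : quadrics_through_Lambda R -> gen R s \is d.-homog.
Proof.
move=> hR; apply: dhomogM2; last by have [] := hR s.2.
by rewrite dhomogX /=; have := enum_valP s.1; rewrite inE.
Qed.

Lemma gen_Lambda R s : quadrics_through_Lambda R -> in_ideal_Lambda (gen R s).
Proof. by move=> hR; apply: in_idealMl; have [] := hR s.2. Qed.

Lemma homog_expand (F : {mpoly k[n.+1]}) : F \is e.-homog ->
  F = \sum_(i < #|mons|) F@_(bmnm (enum_val i)) *: 'X_[bmnm (enum_val i)].
Proof.
move=> hF; have sF : (msize F <= e.+1)%N.
  by rewrite msizeE; apply/bigmax_leqP_seq => m /(dhomog_mf hF) /= ->.
rewrite {1}(mpolywE sF) (bigID (mem mons)) /= [X in _ + X]big1.
  by rewrite addr0 [LHS]big_enum_val.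
move=> m; rewrite inE => me; apply/eqP; rewrite scaler_eq0; apply/orP; left.
apply: contraR me; rewrite -mcoeff_msupp => mF.
by have := dhomog_mf hF mF => /= ->.
Qed.

(** The row space of the generators then contains the kernel of the evaluation
    map on Gamma, whose codimension is at most the degree of Gamma. *)
Lemma codim_gen_mx :
  (forall F, residual_form p' d F -> in_ideal predT Q' F) ->
  (Ldim n d <= \rank gen_mx + degree_count p')%N.
Proof.
move=> full; rewrite -card_gamma_index.
have ker_gen : (kermx (gamma_mx p' d) <= gen_mx)%MS.
  apply/row_subP => a; set w := row a _.
  have w0 : w *m gamma_mx p' d = 0 by rewrite -row_mul mulmx_ker row0.
  have hw := Lpoly_homog w.
  have : exists h, Lpoly w = \sum_i h i * Q' i.
    by apply: full; split; [| exact: Lpoly_Lambda | exact/gamma_kernel].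
  case/(in_ideal_homog (fun i => (Q'_quadrics i).1) hw) => h [hh wE].
  rewrite -(LpolyK w) wE Lrow_sum; apply: summx_sub => i _.
  rewrite (homog_expand (hh i)) mulr_suml Lrow_sum; apply: summx_sub => j _.
  rewrite -scalerAl LrowZ; apply: scalemx_sub.
  have -> : Lrow d ('X_[bmnm (enum_val j)] * Q' i) = row (enum_rank (j, i)) gen_mx.
    by rewrite rowK enum_rankK.
  exact: row_sub.
have := leq_trans (leqnn _) (mxrankS ker_gen); rewrite mxrank_ker.
by have := rank_leq_col (gamma_mx p' d); lia.
Qed.

(** The points of Gamma, lifted along the pencil from Q to Q', give independent
    functionals on the forms of degree e + 2 vanishing on the plane which kill
    the ideal of the pencil to arbitrary order. *)
Lemma rank_gen_mx :
  (forall v : (forall i, resfield (p i)), exists F,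
    [/\ F \is d.-homog, in_ideal_Lambda F
      & forall i, eval_at F (@coord_of k n (p i)) = v i]) ->
  (\rank gen_mx + degree_count p <= Ldim n d)%N.
Proof.
move=> interp; rewrite -card_gamma_index.
pose f := maxrankfun gen_mx.
have /row_freeP[Z fZ] : row_free (rowsub f gen_mx) by apply: maxrowsub_free.
(* v t is the basis element of index t of the coordinate ring of Gamma *)
pose v (t : gamma_index p) i : resfield (p i) :=
  \sum_(j < \dim {:resfield (p i)})
    (Tagged (fun i => 'I_(\dim {:resfield (p i)})) j == t)%:R *: (vbasis {:resfield (p i)})`_j.
have [F hF] := fin_all_exists (fun t => interp (v t)).
pose P : 'M[{poly k}]_(\rank gen_mx, Ldim n d) := \matrix_(a, i)
  ((1 - 'X) * ((gen Q (enum_val (f a)))@_(Lmon i))%:P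
   + 'X * ((gen Q' (enum_val (f a)))@_(Lmon i))%:P).
pose Y := \matrix_(t < #|{: gamma_index p}|) Lrow d (F (enum_val t)).
apply: (@rank_deformation _ _ _ _ P Y Z).
  rewrite -[RHS]fZ; congr (_ *m _); apply/matrixP => a i; rewrite !mxE.
  by rewrite /horner_eval !hornerE subrr mul0r add0r.
move=> N; have [x hx] := fin_all_exists (fun i => lift_point Q_quadrics Qp i Q'_quadrics N).
exists (\matrix_(i, s) gamma_coord_poly (s := enum_val s)
          (mmap1 (x (tag (enum_val s))) (Lmon i))).
split=> [a s|].
  set s' := enum_val s; set b := enum_val (f a).
  have [x0 xN] := hx (tag s').
  have genx R : quadrics_through_Lambda R ->
      mmap (polyC \o GRing.in_alg _) (x (tag s')) (gen R b)
    = \sum_(i < Ldim n d) (((gen R b)@_(Lmon i))%:A)%:P * mmap1 (x (tag s')) (Lmon i).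
    move=> hR; rewrite -[in LHS](LrowK (gen_homog b hR) (gen_Lambda b hR)) mmap_Lpoly.
    by apply: eq_bigr => i _; rewrite mxE.
  have -> : (P *m \matrix_(i, s) gamma_coord_poly (s := enum_val s)
          (mmap1 (x (tag (enum_val s))) (Lmon i))) a s
      = gamma_coord_poly (s := s')
         ((1 - 'X) * mmap (polyC \o GRing.in_alg _) (x (tag s')) (gen Q b)
          + 'X * mmap (polyC \o GRing.in_alg _) (x (tag s')) (gen Q' b)).
    rewrite !genx // !mulr_sumr -big_split gcp_sum mxE; apply: eq_bigr => i _ /=.
    rewrite !mxE -gcp_linear; congr gamma_coord_poly.
    rewrite rmorphD !rmorphM rmorphB rmorph1 /= map_polyX !map_polyC /= -/s' -/b.
    by rewrite mulrDl !mulrA.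
  rewrite /gen !rmorphM /= mulrCA [X in _ + X]mulrCA -mulrDr.
  have /dvdpP[g ->] := xN b.2.
  rewrite mulrCA mulrC -[X in X * _]mulr1 -(map_polyXn (GRing.in_alg _)) mulr1.
  by rewrite -mulrA mulrCA gcp_linear dvdp_mulr.
have -> : map_mx (horner_eval 0) (\matrix_(i, s) gamma_coord_poly (s := enum_val s)
          (mmap1 (x (tag (enum_val s))) (Lmon i))) = gamma_mx p d.
  apply/matrixP => i s; rewrite !mxE /horner_eval horner_coef0 coef_gcp.
  rewrite -horner_coef0; congr gamma_coord.
  rewrite /mmap1 horner_prod; apply: eq_bigr => j _; rewrite horner_exp.
  by rewrite (hx _).1.
apply/matrixP => t s.
have -> : (Y *m gamma_mx p d) t s = (row t Y *m gamma_mx p d) 0 s.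
  by rewrite -row_mul [RHS]mxE.
rewrite gamma_mxE rowK; have [hFt FtL Ftv] := hF (enum_val t).
rewrite LrowK // Ftv /gamma_coord /v coord_sum_free ?(basis_free (vbasisP _)) //.
rewrite [RHS]mxE -(inj_eq enum_val_inj) eq_sym; congr (_ == _)%:R.
by case: (enum_val s).
Qed.

End Degree.

(** Compare the ideal of Q' in one large degree with Gamma' on one side, and with
    Gamma moved along the pencil on the other. *)
Lemma degree_count_le : (degree_count p <= degree_count p')%N.
Proof.
have [d1 interp] := interpolation (residual_distinct Qp) (residual_disjoint Qp).
have [d0 full] := residual_form_in_ideal Qp'.
pose e := (d0 + d1)%N.
have := @rank_gen_mx e (interp (e + 2)%N _).
have := @codim_gen_mx e (fun F => @full (e + 2)%N F _).
by rewrite /e; lia.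
Qed.

End Invariance.

(** * Discriminants of trace forms *)

Section Discriminant.
Variable k : fieldType.

Lemma congruent_det m n (A : 'M[k]_m) (B : 'M[k]_n) : congruent A B ->
  exists u, \det A = u ^+ 2 * \det B.
Proof.
case=> R [R' [RR' R'R <-]].
have mn : m = n.
  by apply/eqP; rewrite eqn_leq (mulmx1_min RR') (mulmx1_min R'R).
case: n / mn in B R R' RR' R'R *; exists (\det R).
by rewrite !det_mulmx det_tr; ring.
Qed.

(** The discriminant modulo squares is an invariant of the class in GW(k): the
    auxiliary form in the definition of the Grothendieck group cancels, its
    determinant being nonzero. *)
Lemma gw_of_form_det (a b : symbform k) : gw_of_form a = gw_of_form b ->
  exists u, \det (tagged (gram a)) = u ^+ 2 * \det (tagged (gram b)).
Proof.
rewrite /gw_of_form => /eqP/gw_eqP[c] /congruent_det[u] /=.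
rewrite /dsum_mx !det_ublock det_mx00 !mulr1 mulrA => /mulIf E.
exists u; apply: E; have /andP[_] := gramP c.
by rewrite unitmxE unitfE.
Qed.

Section TraceForm.
Variable E : fieldExtType k.
Hypothesis dimE_neq0 : (\dim {:E})%:R != 0 :> k.

Lemma field_trace1 : field_trace (1 : E) = (\dim {:E})%:R.
Proof.
by rewrite /field_trace amull1 passmx.mxof1 ?(basis_free (vbasisP _)) // mxtrace1.
Qed.

Lemma field_trace_linear : scalar (@field_trace k E).
Proof. by move=> c x y; rewrite /field_trace linearP passmx.mxof_linear mxtraceD mxtraceZ. Qed.

HB.instance Definition _ :=
  GRing.isLinear.Build k E k *%R (@field_trace k E) field_trace_linear.

Let field_traceZ c (x : E) : field_trace (c *: x) = c * field_trace x.
Proof. exact: linearZ_LR. Qed.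

Local Notation gramE a := (gram_matrix (fun x y : E => field_trace (a * x * y))).

(** If x is orthogonal to E and nonzero, pairing it with (a x)^-1 gives the trace
    of 1, which is the dimension. *)
Lemma gram_trace_symform (a : E) : a != 0 ->
  symform (Tagged (fun m => 'M[k]_m) (gramE a)).
Proof.
move=> a0; apply/andP; split => /=.
  by apply/eqP/matrixP => i j; rewrite !mxE mulrAC.
rewrite -row_free_unit; apply/row_freeP; exists (invmx (gramE a)).
apply: mulmxV; rewrite -row_free_unit -kermx_eq0; apply/rowV0P => w /sub_kermxP w0.
pose x := \sum_i w 0 i *: (vbasis {:E})`_i.
have tr0 y : field_trace (a * x * y) = 0.
  rewrite (coord_basis (vbasisP _) (memvf y)) mulr_sumr raddf_sum big1 // => j _.
  have := congr1 (fun v : 'rV_ _ => v 0 j) w0; rewrite !mxE => E0.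
  rewrite /= -scalerAr field_traceZ.
  suff -> : field_trace (a * x * (vbasis {:E})`_j) = 0 by rewrite mulr0.
  rewrite -[RHS]E0 /x mulr_sumr mulr_suml raddf_sum; apply: eq_bigr => i _ /=.
  by rewrite mxE -scalerAr -scalerAl field_traceZ.
have x0 : x = 0.
  apply: contra_eq (tr0 (a * x)^-1) => x0.
  by rewrite mulfV ?field_trace1 // mulf_neq0.
apply/rowP => i; rewrite mxE -(coord_sum_free (fun i => w 0 i) i (basis_free (vbasisP _))).
by rewrite -/x x0 linear0.
Qed.

(** Changing the sign of a unit changes the discriminant of its trace form by
    (-1)^dim, which for odd dim is a square only if -1 is. *)
Lemma gw_trace_unit_opp (a : E) : a != 0 -> odd (\dim {:E}) ->
  (forall u : k, u ^+ 2 != -1) -> gw_trace_unit (- a) <> gw_trace_unit a.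
Proof.
move=> a0 odd_dim no_sqrt; rewrite /gw_trace_unit /gw_class.
rewrite (insubT _ (gram_trace_symform a0)).
have Na0 : - a != 0 by rewrite oppr_eq0.
rewrite (insubT _ (gram_trace_symform Na0)) => /gw_of_form_det[u] /=.
have -> : gramE (- a) = (-1) *: gramE a.
  by apply/matrixP => i j; rewrite !mxE !mulNr linearN mul1r.
rewrite detZ -signr_odd odd_dim expr1 => /mulIf E0; have /andP[_] := gram_trace_symform a0.
by rewrite /= unitmxE unitfE => /E0 uE; have := no_sqrt u; rewrite -uE eqxx.
Qed.

End TraceForm.
End Discriminant.

(** * Nonvanishing of polynomials over the rationals *)

Lemma digits_inj b m (f g : 'I_m -> nat) :
  (forall i, f i < b)%N -> (forall i, g i < b)%N ->
  (\sum_i f i * b ^ i = \sum_i g i * b ^ i)%N -> f =1 g.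
Proof.
elim: m => [|m IH] in f g *; first by move=> _ _ _ [].
move=> hf hg; have b0 : (0 < b)%N by apply: leq_ltn_trans (hf ord0).
rewrite !big_ord_recl expn0 !muln1.
have shift (h : 'I_m.+1 -> nat) : (\sum_(i < m) h (lift ord0 i) * b ^ lift ord0 i
    = (\sum_(i < m) h (lift ord0 i) * b ^ i) * b)%N.
  by rewrite big_distrl; apply: eq_bigr => i _; rewrite expnSr mulnA.
rewrite !shift ![(_ ord0 + _)%N]addnC => E.
have E0 : f ord0 = g ord0.
  by have := congr1 (modn^~ b) E; rewrite !modnMDl !modn_small.
have E1 : (\sum_(i < m) f (lift ord0 i) * b ^ i
           = \sum_(i < m) g (lift ord0 i) * b ^ i)%N.
  by have := congr1 (divn^~ b) E; rewrite !divnMDl // !divn_small // !addn0.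
move=> i; case: (unliftP ord0 i) => [j|] -> //.
by apply: (IH (f \o lift ord0) (g \o lift ord0)) => //= ?.
Qed.

Lemma nonroot (F : numFieldType) (q : {poly F}) : q != 0 -> exists a, q.[a] != 0.
Proof.
move=> q0; apply: contrapT => no_nonroot.
pose s : seq F := [seq i%:R | i <- iota 0 (size q)].
have := max_poly_roots q0 (_ : all (root q) s) (_ : uniq s).
rewrite /s size_map size_iota ltnn => H; have//: false; apply: H.
  apply/allP => a _; apply/eqP; apply: contrapT => /eqP qa.
  by apply: no_nonroot; exists a.
rewrite map_inj_uniq ?iota_uniq // => i j /eqP.
by rewrite Num.Theory.eqr_nat => /eqP.
Qed.

(** Kronecker's substitution x_i = y^(b^i), with b larger than all exponents of
    f, sends distinct monomials of f to distinct powers of y. *)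
Lemma mpoly_nonroot (F : numFieldType) m (f : {mpoly F[m]}) : f != 0 ->
  exists x : 'I_m -> F, f.@[x] != 0.
Proof.
move=> f0; pose b := (msize f).
pose w (mo : 'X_{1..m}) := (\sum_i mo i * b ^ i)%N.
pose q : {poly F} := \sum_(mo <- msupp f) f@_mo *: 'X^(w mo).
have lt_b mo i : mo \in msupp f -> (mo i < b)%N.
  move/msize_mdeg_lt; apply: leq_ltn_trans.
  by rewrite mdegE (bigD1 i) //= leq_addr.
have [|y qy] := @nonroot F q.
  have lf := mlead_supp f0.
  have : q`_(w (mlead f)) != 0.
    rewrite coef_sum (bigD1_seq (mlead f)) ?msupp_uniq //= big_seq_cond big1 ?addr0.
      by rewrite coefZ coefXn eqxx mulr1 mleadc_eq0.
    move=> mo /andP[mos ne]; rewrite coefZ coefXn; case: eqP => [E|]; last by rewrite mulr0.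
    case/eqP: ne; apply/mnmP/(@digits_inj b) => [i|i|]; try exact: lt_b.
    exact: esym.
  by apply: contra_neq => ->; rewrite coef0.
exists (fun i => y ^+ (b ^ i)); apply: contraNneq qy => fy; apply/eqP.
rewrite -{}fy mevalE horner_sum; apply: eq_bigr => mo _.
rewrite hornerZ hornerXn; congr (_ * _); rewrite /w expr_sum.
by apply: eq_bigr => i _; rewrite -exprM mulnC.
Qed.

(** * Three quadrics in space containing a plane *)

Section PlaneAndPoint.
Variables (k : fieldType) (A : 'M[k]_(3, 4)) (c : 'I_4 -> k).
Hypothesis c_max : c ord_max = 1.
Hypothesis Ac : forall i, \sum_a A i a * c a = 0.
Hypothesis A_unit : \matrix_(i, j) A i (lift ord_max j) \in unitmx.
Implicit Types (F : {mpoly k[4]}).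

(** The scheme cut out is the plane x_3 = 0 together with the point c where the
    three linear forms vanish. *)
Definition lin_form i : {mpoly k[4]} := \sum_a A i a *: 'X_a.
Definition plane_quadric i : {mpoly k[4]} := 'X_ord_max * lin_form i.

Lemma plane_quadrics_through : quadrics_through_Lambda plane_quadric.
Proof.
move=> i; split.
  apply: (@dhomogM2 _ _ 1 1); first by rewrite dhomogX /= mdeg1.
  by apply: rpred_sum => a _; apply: dhomogZ; rewrite dhomogX /= mdeg1.
by rewrite /plane_quadric mulrC; apply/in_idealMl/(@in_ideal_gen _ _ _ _ (fun j => 'X_j)).
Qed.

Lemma rational_point_gen :
  <<1 & [seq (c i : k^o) / c j | i <- enum 'I_4, j <- enum 'I_4]>>%VS = fullv.
Proof.
by apply/eqP; rewrite eqEsubv subvf /= regular_fullv subv_adjoin_seq.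
Qed.

Lemma rational_point_neq0 : exists l, (c l : k^o) != 0.
Proof. by exists ord_max; rewrite c_max oner_eq0. Qed.

Definition rational_point : closed_point k 3 :=
  @ClosedPoint k 3 k^o c rational_point_neq0 rational_point_gen.

Local Notation evc F := (@eval_at k 3 k^o F c).

Lemma evcX a : evc 'X_a = c a.
Proof. by rewrite /eval_at mmapX mmap1U. Qed.

Lemma evc_lin i : evc (lin_form i) = 0.
Proof.
rewrite -[RHS](Ac i) /eval_at raddf_sum; apply: eq_bigr => a _ /=.
by rewrite mmapZ mmapX mmap1U mulr_algl.
Qed.

Lemma evc_quadric i : evc (plane_quadric i) = 0.
Proof. by rewrite /eval_at rmorphM /= -!/(evc _) evc_lin mulr0. Qed.

(** The linear forms span all those vanishing at c, by inverting the minor of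
    their matrix that omits the last column. *)
Lemma variable_mod_lin a : in_ideal predT lin_form ('X_a - c a *: 'X_ord_max).
Proof.
set D := invmx (\matrix_(i, j) A i (lift ord_max j)).
case: (unliftP ord_max a) => [b ->|->]; last first.
  by rewrite c_max scale1r subrr; apply: in_ideal0.
have -> : 'X_(lift ord_max b) - c (lift ord_max b) *: 'X_ord_max
    = \sum_i D b i *: lin_form i.
  have linE i : lin_form i = \sum_j A i (lift ord_max j) *:
      ('X_(lift ord_max j) - c (lift ord_max j) *: 'X_ord_max).
    rewrite /lin_form (bigD1_ord ord_max) //=.
    have := Ac i; rewrite (bigD1_ord ord_max) //= c_max mulr1 => /eqP.
    rewrite addr_eq0 => /eqP ->; rewrite scaleNr scaler_suml -sumrN -big_split.
    apply: eq_bigr => j _ /=; rewrite scalerBr scalerA addrC //.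
  under eq_bigr => i _ do rewrite linE scaler_sumr.
  rewrite exchange_big (bigD1 b) //=.
  have DA j : \sum_i D b i * A i (lift ord_max j) = (b == j)%:R.
    have := mulVmx A_unit => /matrixP/(_ b j); rewrite !mxE => <-.
    by apply: eq_bigr => i _; rewrite mxE.
  rewrite [X in _ = _ + X]big1 ?addr0 => [|j jb].
    by under eq_bigr do rewrite scalerA; rewrite -scaler_suml DA eqxx scale1r.
  by under eq_bigr do rewrite scalerA; rewrite -scaler_suml DA eq_sym (negPf jb) scale0r.
by apply: in_ideal_sum => i _; apply/in_idealZ/in_ideal_gen.
Qed.

Lemma monomial_mod_lin m :
  in_ideal predT lin_form ('X_[m] - evc 'X_[m] *: 'X_ord_max ^+ mdeg m).
Proof.
elim: {m}(mdeg m) {-2}m (erefl (mdeg m)) => [|d IH] m dm.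
  move/eqP: dm; rewrite mdeg_eq0 => /eqP ->.
  by rewrite mpolyX0 mdeg0 expr0 /eval_at rmorph1 scale1r subrr; apply: in_ideal0.
have [m1 [m2 [E /eqP/mdeg1P[a /eqP m1a] d2]]] := mnm_split (dm : mdeg m = (1 + d)%N).
rewrite dm {m dm}E {m1}m1a mpolyXD.
have -> : evc ('X_a * 'X_[m2]) = c a * evc 'X_[m2].
  by rewrite /eval_at rmorphM /= -!/(evc _) evcX.
have -> : 'X_a * 'X_[m2] - (c a * evc 'X_[m2]) *: 'X_ord_max ^+ d.+1
    = 'X_[m2] * ('X_a - c a *: 'X_ord_max)
      + (c a *: 'X_ord_max) * ('X_[m2] - evc 'X_[m2] *: 'X_ord_max ^+ d).
  by rewrite exprS -!mul_mpolyC mpolyCM; ring.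
apply: in_idealD; first exact/in_idealMl/variable_mod_lin.
by apply: in_idealMl; rewrite -[X in _ ^+ X]d2; apply: IH.
Qed.

(** A form of degree d vanishing on the plane is x_3 G, and modulo the three linear
    forms G is G(c) times a power of x_3, so that x_3 G lies in the ideal of the
    quadrics as soon as it vanishes at c: this ideal is already saturated. *)
Lemma residual_point : is_residual plane_quadric (fun _ : 'I_1 => rational_point).
Proof.
split=> [i j _|_ /(_ ord_max isT) /= /eqP|_|d F hF]; first by rewrite !ord1.
- by rewrite c_max oner_eq0.
- by rewrite regular_fullv separable_refl.
split=> [[N satN]|[FL /(_ ord0) Fc]]; last first.
  exists 0%N => m /eqP; rewrite mdeg_eq0 => /eqP ->; rewrite mpolyX0 mul1r.
  have -> : F = \sum_i Lrow d F 0 i *: ('X_[Lmon i] - evc 'X_[Lmon i] *: 'X_ord_max ^+ d).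
    under eq_bigr do rewrite scalerBr scalerA; rewrite sumrB -scaler_suml.
    have -> : \sum_i Lrow d F 0 i * evc 'X_[Lmon i] = evc F.
      rewrite -[in RHS](LrowK hF FL) /eval_at raddf_sum; apply: eq_bigr => i _ /=.
      by rewrite mmapZ mulr_algl.
    by rewrite (Fc : evc F = 0) scale0r subr0 -{1}(LrowK hF FL).
  apply: in_ideal_sum => i _; apply: in_idealZ.
  have /existsP[j /andP[j3 mj]] := Lmon_off i.
  have jmax : j = ord_max by apply/val_inj => /=; have := ltn_ord j; lia.
  rewrite {j}jmax in mj j3.
  pose m' := (Lmon i - U_(ord_max))%MM.
  have mE : Lmon i = (m' + U_(ord_max))%MM by rewrite submK // lep1mP.
  have dE : d = (mdeg m').+1.
    by have := congr1 mdeg mE; rewrite mdegD mdeg1 Lmon_deg addn1.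
  have -> : 'X_[Lmon i] - evc 'X_[Lmon i] *: 'X_ord_max ^+ d
      = 'X_ord_max * ('X_[m'] - evc 'X_[m'] *: 'X_ord_max ^+ mdeg m').
    rewrite mE [X in _ ^+ X]dE mpolyXD /eval_at rmorphM /= -!/(evc _) evcX c_max mulr1.
    by rewrite exprS -!mul_mpolyC; ring.
  have [h ->] := monomial_mod_lin m'; exists h; rewrite mulr_sumr.
  by apply: eq_bigr => b _; rewrite mulrCA.
split=> [|_].
  have inL : in_ideal_Lambda ('X_[U_(ord0) *+ N] * F).
    apply: in_ideal_sub (satN _ _) => [i _|]; last by rewrite mdegMn mdeg1 mul1n.
    by have [] := plane_quadrics_through i.
  apply/in_LambdaP => m mF; move/in_LambdaP: inL => /(_ (U_(ord0) *+ N + m)%MM).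
  rewrite mcoeff_msupp (mulrC _ F) mcoeffMX -mcoeff_msupp => /(_ mF)/existsP[j /andP[j3 mj]].
  apply/existsP; exists j; rewrite j3 /=.
  move: mj; rewrite mnmDE mulmnE mnm1E; case: (ord0 =P j) => [j0|_]; last by rewrite mul0n add0n.
  by rewrite -j0 in j3.
have [|h E] := satN (U_(ord_max) *+ N)%MM; first by rewrite mdegMn mdeg1 mul1n.
have := congr1 (fun F => evc F) E; rewrite /vanishes_at /=.
have -> : evc (\sum_i h i * plane_quadric i) = 0.
  rewrite /eval_at raddf_sum big1 // => i _ /=; rewrite rmorphM /= -!/(evc _).
  by rewrite evc_quadric mulr0.
rewrite /eval_at rmorphM /= -mpolyXn rmorphXn /= -!/(evc _) evcX c_max.
by rewrite expr1n mul1r.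
Qed.

(** In the chart x_l != 0 only the derivatives of the linear forms survive at
    the point, so the Jacobian is, up to a nonzero factor, a maximal minor of
    their matrix of coefficients. *)
Lemma jac_chartE l : c l != 0 ->
  jac_chart plane_quadric rational_point l
  = (-1) ^+ l * ((c l)^-1 ^+ 3 * \det (\matrix_(i, j) A i (lift l j))).
Proof.
move=> cl; rewrite /jac_chart; congr (_ * _).
rewrite -detZ; congr (\det _); apply/matrixP => i j; rewrite !mxE.
pose S : 4.-tuple {mpoly k[4]} := [tuple if j == l then 1 else 'X_j | j < 4].
pose y m : k^o := c m / c l.
have SX a : 'X_a \mPo S = if a == l then 1 else 'X_a.
  by rewrite comp_mpolyXU -tnth_nth tnth_mktuple.
have evS a : @eval_at k 3 k^o ('X_a \mPo S) y = c a / c l.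
  rewrite SX; case: eqP => [->|_]; first by rewrite /eval_at rmorph1 mulfV.
  by rewrite /eval_at mmapX mmap1U.
have linS : lin_form i \mPo S = \sum_a A i a *: ('X_a \mPo S).
  by rewrite raddf_sum; apply: eq_bigr => a _; rewrite /= comp_mpolyZ.
rewrite /dehomog /plane_quadric rmorphM /= mderivM /eval_at rmorphD !rmorphM /=.
rewrite -!/(@eval_at k 3 k^o _ y) -/S evS c_max mul1r.
have -> : @eval_at k 3 k^o (lin_form i \mPo S) y = 0.
  rewrite linS /eval_at raddf_sum /=.
  under eq_bigr => a _ do rewrite mmapZ -/(@eval_at k 3 k^o _ y) evS mulr_algl.
  rewrite -[RHS](mul0r (c l)^-1) -[in RHS](Ac i) [RHS]mulr_suml.
  by apply: eq_bigr => a _; apply: mulrA.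
rewrite mulr0 add0r; congr (_ * _).
rewrite linS raddf_sum (bigD1 (lift l j)) //= mderivZ SX.
rewrite eq_sym (negPf (neq_lift _ _)) mderivX mnm1E eqxx scale1r -[X in (X - _)%MM]add0m addmK mpolyX0.
rewrite big1 ?addr0 => [|a aj]; last first.
  rewrite mderivZ SX; case: eqP => _; first by rewrite mderivC scaler0.
  by rewrite mderivX mnm1E (negPf aj) scale0r scaler0.
by rewrite /eval_at mmapZ rmorph1 mulr_algl -[LHS]/(_ * 1) mulr1.
Qed.

(** A vector killed by the minor extends by 0 in position l to a vector of the
    kernel of A, which is the line of c, where the l-th component is nonzero. *)
Lemma minor_neq0 l : c l != 0 -> \det (\matrix_(i, j) A i (lift l j)) != 0.
Proof.
move=> cl; rewrite -unitfE -unitmxE -unitmx_tr -row_free_unit -kermx_eq0.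
apply/rowV0P => w /sub_kermxP w0.
pose v a := if unlift l a is Some b then w 0 b else 0.
have vl : v l = 0 by rewrite /v unlift_none.
have vb b : v (lift l b) = w 0 b by rewrite /v liftK.
have Av i : \sum_a A i a * v a = 0.
  rewrite (bigD1_ord l) //= vl mulr0 add0r.
  have := congr1 (fun u : 'rV_3 => u 0 i) w0; rewrite !mxE => E0.
  by rewrite -[RHS]E0; apply: eq_bigr => b _; rewrite vb !mxE mulrC.
pose u := \col_b (v (lift ord_max b) - v ord_max * c (lift ord_max b)).
have u0 : u = 0.
  rewrite -[u]mul1mx -(mulVmx A_unit) -mulmxA; set B := _ *m u.
  suff -> : B = 0 by rewrite mulmx0.
  have Ec i : A i ord_max = - \sum_(j < 3) A i (lift ord_max j) * c (lift ord_max j).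
    apply/eqP; rewrite -addr_eq0; apply/eqP.
    by rewrite -[RHS](Ac i) [RHS](bigD1_ord ord_max) //= c_max mulr1.
  have Ev i : \sum_(j < 3) A i (lift ord_max j) * v (lift ord_max j)
      = - (A i ord_max * v ord_max).
    apply/eqP; rewrite -addr_eq0 addrC; apply/eqP.
    by rewrite -[RHS](Av i) [RHS](bigD1_ord ord_max).
  apply/colP => i; rewrite !mxE.
  transitivity (\sum_(j < 3) A i (lift ord_max j) * v (lift ord_max j)
    - v ord_max * \sum_(j < 3) A i (lift ord_max j) * c (lift ord_max j)).
    by rewrite mulr_sumr -sumrB; apply: eq_bigr => j _; rewrite !mxE; ring.
  by rewrite Ev Ec; ring.
have vE a : v a = v ord_max * c a.
  case: (unliftP ord_max a) => [b ->|->]; last by rewrite c_max mulr1.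
  by have := congr1 (fun M : 'cV_3 => M b 0) u0; rewrite !mxE => /subr0_eq.
have vmax : v ord_max = 0.
  by have := vE l; rewrite vl => /esym/eqP; rewrite mulf_eq0 (negPf cl) orbF => /eqP.
by apply/rowP => b; rewrite mxE -vb vE vmax mul0r.
Qed.

End PlaneAndPoint.

(** * Two rational counts of opposite sign *)

(** In characteristic 0 an irreducible polynomial cannot divide its derivative. *)
Lemma perfect_rat : perfect_field rat.
Proof.
move=> f [size_f irr_f]; have f0 : f != 0 by rewrite -size_poly_gt0 ltnW.
have f'0 : f^`() != 0.
  apply: contraTneq size_f => f'0; rewrite -leqNgt leqNgt; apply/negP => size_f.
  have := congr1 (fun q : {poly rat} => q`_(size f).-2) f'0.
  rewrite coef_deriv coef0 -(prednK (_ : 0 < (size f).-1)%N); last by case: (size f) size_f => [|[]].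
  move/eqP; rewrite Num.Theory.mulrn_eq0 /= prednK; last by case: (size f) size_f => [|[]].
  by rewrite -lead_coefE lead_coef_eq0 (negPf f0).
rewrite unlock /coprimep; apply: contraT => /irr_f /(_ (dvdp_gcdl _ _)) gcd_f.
have := dvdp_leq f'0 (dvdp_gcdr f f^`()).
by rewrite (eqp_size gcd_f) leqNgt lt_size_deriv.
Qed.

Lemma gw_count1 (k : fieldType) n (R : 'I_n -> {mpoly k[n.+1]})
    (p : closed_point k n) :
  gw_count R (fun _ : 'I_1 => p) = gw_trace_unit (jac R p).
Proof. by rewrite /gw_count big_ord_recl big_ord0 addr0. Qed.

Section GeneralQuadrics.

Definition param_of (i : 'I_3) (a : 'I_4) : param 3 :=
  exist _ (i, (a, ord_max)) (introT andP (conj (leq_ord a) (leqnn 3))).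

Definition coef_mx (y : 'I_#|param 3| -> rat) : 'M[rat]_(3, 4) :=
  \matrix_(i, a) y (enum_rank (param_of i a)).

Lemma param_coordE y t :
  param_coord (plane_quadric (coef_mx y)) t = y (enum_rank t).
Proof.
case: t => [[i [a b]] tP]; have [/= _ b3] := andP tP.
have bmax : b = ord_max by apply/val_inj => /=; have := ltn_ord b; lia.
rewrite {b}bmax in tP b3 *.
rewrite /param_coord /= /plane_quadric mulr_sumr raddf_sum (bigD1 a) //= big1 ?addr0.
  rewrite -scalerAr -mpolyXD mcoeffZ mcoeffX addmC eqxx mulr1 mxE.
  by congr (y (enum_rank _)); apply: val_inj.
move=> j ja; rewrite -scalerAr -mpolyXD mcoeffZ mcoeffX addmC eqm_add2r eq_mnm1.
by rewrite (negPf ja) mulr0.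
Qed.

Lemma in_basic_openE f y :
  in_basic_open f (plane_quadric (coef_mx y)) = (f.@[y] != 0 : Prop).
Proof.
rewrite /in_basic_open; congr (is_true (_ != _)); apply: meval_eq => s.
by rewrite param_coordE enum_valK.
Qed.

(** Negating one quadric does not change the scheme, and it negates the Jacobian. *)
Definition flip_sign (i : 'I_3) : rat := if i == ord0 then -1 else 1.
Definition flip (y : 'I_#|param 3| -> rat) s := flip_sign (val (enum_val s)).1 * y s.

Lemma coef_mx_flip y i a : coef_mx (flip y) i a = flip_sign i * coef_mx y i a.
Proof. by rewrite !mxE /flip enum_rankK. Qed.

Definition flip_poly (f : {mpoly rat[#|param 3|]}) : {mpoly rat[#|param 3|]} :=
  f \mPo [tuple flip_sign (val (enum_val s)).1 *: 'X_s | s < #|param 3|].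

Lemma flip_polyE f y : (flip_poly f).@[y] = f.@[flip y].
Proof.
rewrite comp_mpoly_meval; apply: meval_eq => s.
by rewrite tnth_mktuple mevalZ mevalXU.
Qed.

Lemma flipK y : flip (flip y) =1 y.
Proof.
move=> s; rewrite /flip mulrA /flip_sign; case: ifP => _; last by rewrite !mul1r.
by rewrite mulrN1 opprK mul1r.
Qed.

Lemma flip_poly_neq0 f : f != 0 -> flip_poly f != 0.
Proof.
case/mpoly_nonroot => y; rewrite -(meval_eq f (flipK y)) -flip_polyE.
by apply: contraNneq => ->; rewrite meval0.
Qed.

(** Its nonvanishing at the coefficients of the quadrics makes their residual scheme
    a rational point outside the plane. *)
Definition minor_poly : {mpoly rat[#|param 3|]} :=
  \det (\matrix_(i < 3, j < 3) 'X_(enum_rank (param_of i (lift ord_max j)))).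

Lemma minor_polyE y :
  minor_poly.@[y] = \det (\matrix_(i, j) coef_mx y i (lift ord_max j)).
Proof.
rewrite /minor_poly -(det_map_mx (meval y)); congr (\det _).
by apply/matrixP => i j; rewrite !mxE /= mevalXU.
Qed.

Lemma minor_poly_neq0 : minor_poly != 0.
Proof.
pose y (s : 'I_#|param 3|) : rat := let t := val (enum_val s) in (lift ord_max t.1 == t.2.1)%:R.
have : minor_poly.@[y] != 0.
  rewrite minor_polyE (_ : \matrix_(i, j) _ = 1%:M) ?det1 ?oner_eq0 //.
  apply/matrixP => i j; rewrite !mxE /y enum_rankK /=.
  by rewrite (inj_eq (@lift_inj _ _)).
by apply: contraNneq => ->; rewrite meval0.
Qed.

Lemma common_zero y : minor_poly.@[y] != 0 -> exists c : 'I_4 -> rat,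
  c ord_max = 1 /\ forall i, \sum_a coef_mx y i a * c a = 0.
Proof.
rewrite minor_polyE; set M := \matrix_(i, j) _ => detM.
have uM : M \in unitmx by rewrite unitmxE unitfE.
pose w := - (invmx M *m col ord_max (coef_mx y)).
exists (fun a => if unlift ord_max a is Some b then w b 0 else 1).
split=> [|i]; first by rewrite unlift_none.
rewrite (bigD1_ord ord_max) //= unlift_none mulr1.
have -> : coef_mx y i ord_max = - (M *m w) i 0.
  by rewrite mulmxN mulKVmx // !mxE opprK.
apply/eqP; rewrite addrC subr_eq0; apply/eqP; rewrite [RHS]mxE.
by apply: eq_bigr => j _; rewrite liftK [M _ _]mxE.
Qed.

Lemma det_flip (M : 'M[rat]_3) :
  \det (\matrix_(i, j) (flip_sign i * M i j)) = - \det M.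
Proof.
have -> : \matrix_(i, j) (flip_sign i * M i j) = diag_mx (\row_i flip_sign i) *m M.
  by apply/matrixP => i j; rewrite mul_diag_mx !mxE.
rewrite det_mulmx det_diag !big_ord_recl big_ord0 !mxE /flip_sign /=.
by rewrite !mulr1 mulN1r.
Qed.

Lemma gw_count_flip y c : minor_poly.@[y] != 0 -> c ord_max = 1 ->
  (forall i, \sum_a coef_mx y i a * c a = 0) ->
  exists p : 'I_1 -> closed_point rat 3,
  [/\ is_residual (plane_quadric (coef_mx y)) p,
      is_residual (plane_quadric (coef_mx (flip y))) p
    & gw_count (plane_quadric (coef_mx y)) p
      <> gw_count (plane_quadric (coef_mx (flip y))) p].
Proof.
move=> detA c_max Ac; pose p := rational_point c_max.
have A_unit : \matrix_(i, j) coef_mx y i (lift ord_max j) \in unitmx.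
  by rewrite unitmxE unitfE -minor_polyE.
have flip_minor l : \matrix_(i, j) coef_mx (flip y) i (lift l j) =
    \matrix_(i, j) (flip_sign i * (\matrix_(i, j) coef_mx y i (lift l j)) i j).
  by apply/matrixP => i j; rewrite mxE coef_mx_flip !mxE.
have Ac' i : \sum_a coef_mx (flip y) i a * c a = 0.
  under eq_bigr => a _ do rewrite coef_mx_flip -mulrA.
  by rewrite -mulr_sumr Ac mulr0.
have A'_unit : \matrix_(i, j) coef_mx (flip y) i (lift ord_max j) \in unitmx.
  by rewrite unitmxE unitfE flip_minor det_flip oppr_eq0 -minor_polyE.
exists (fun=> p); split; try exact: residual_point.
rewrite !gw_count1.
set l := odflt ord0 [pick l | @coord_of _ _ p l != 0].
have cl : c l != 0.
  rewrite /l; case: pickP => //= /(_ ord_max).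
  by rewrite c_max oner_eq0.
have jacE : jac (plane_quadric (coef_mx (flip y))) p
    = - jac (plane_quadric (coef_mx y)) p.
  rewrite /jac -/l !jac_chartE // flip_minor det_flip.
  by rewrite !mulrN.
have jac_neq0 : jac (plane_quadric (coef_mx y)) p != 0.
  rewrite /jac -/l jac_chartE // !mulf_neq0 ?expf_neq0 ?invr_eq0 ?oppr_eq0 ?oner_eq0 //.
  exact: (minor_neq0 c_max Ac A_unit cl).
rewrite jacE; apply: nesym.
have dim1 : \dim {:rat^o} = 1%N by rewrite regular_fullv dimv1.
apply: gw_trace_unit_opp => //; rewrite ?dim1 ?oner_eq0 // => u.
by apply/eqP => u2; have := Num.Theory.sqr_ge0 u; rewrite u2.
Qed.

End GeneralQuadrics.

Theorem corollary2p8 :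
  (exists (k : fieldType) (n : nat),
    [/\ perfect_field k, 2%N \notin [pchar k], odd n & (3 <= n)%N] /\
    forall f : {mpoly k[#|param n|]}, f != 0 ->
    exists (Q Q' : 'I_n -> {mpoly k[n.+1]}),
      [/\ quadrics_through_Lambda Q, quadrics_through_Lambda Q',
          in_basic_open f Q & in_basic_open f Q'] /\
      exists (r r' : nat) (p : 'I_r -> closed_point k n)
             (p' : 'I_r' -> closed_point k n),
        [/\ is_residual Q p, is_residual Q' p' &
            gw_count Q p <> gw_count Q' p'])
  /\
  (forall (k : fieldType) (n : nat),
    perfect_field k -> 2%N \notin [pchar k] -> odd n -> (3 <= n)%N ->
    forall (Q Q' : 'I_n -> {mpoly k[n.+1]}),
      quadrics_through_Lambda Q -> quadrics_through_Lambda Q' ->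
    forall (r r' : nat) (p : 'I_r -> closed_point k n)
           (p' : 'I_r' -> closed_point k n),
      is_residual Q p -> is_residual Q' p' ->
      degree_count p = degree_count p').
Proof.
split; last first.
  move=> k n _ _ _ _ Q Q' hQ hQ' r r' p p' Qp Qp'.
  by apply/eqP; rewrite eqn_leq !(degree_count_le hQ hQ' Qp Qp', degree_count_le hQ' hQ Qp' Qp).
exists rat, 3%N; split.
  by split=> //; exact: perfect_rat.
move=> f f0.
have [y] := mpoly_nonroot (mulf_neq0 (mulf_neq0 f0 (flip_poly_neq0 f0)) minor_poly_neq0).
rewrite !mevalM !mulf_eq0 !negb_or => /andP[/andP[fy fy'] detA].
have [c [c_max Ac]] := common_zero detA.
have [p [Qp Q'p neq]] := gw_count_flip detA c_max Ac.
exists (plane_quadric (coef_mx y)), (plane_quadric (coef_mx (flip y))).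
split; last by exists 1%N, 1%N, p, p; exact: (And3 Qp Q'p neq).
split; [exact: plane_quadrics_through | exact: plane_quadrics_through | | ].
  by rewrite in_basic_openE.
by rewrite in_basic_openE -flip_polyE.
Qed.
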